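(* Let $f_1(z),\ldots,f_n(z)\in\mathbb{C}(z)$ be rational functions such that no $f_i(z)$ is the derivative of a rational function in $\mathbb{C}(z)$, and for $i=1,\ldots,n$ let $y_i\in\mathcal{U}$ be a solution of $$(E_i):\quad y''/y'=f_i(y).$$ Then $\operatorname{trdeg}_{\mathbb{C}}\mathbb{C}(y_1,y_1',\ldots,y_n,y_n')=2n$ unless for some $i\neq j$ and some $(a,b)\in\mathbb{C}^\ast\times\mathbb{C}$ we have $y_i=ay_j+b$. In that case we also have $f_j(z)=f_i(az+b)$.
   Context: $(\mathcal{U},\delta)$ is a saturated model of $DCF_0$ (differentially closed fields of characteristic zero with one derivation, $y'=\delta(y)$), whose field of constants is $\mathbb{C}$. A solution of $y''/y'=f_i(y)$ is a $y\in\mathcal{U}$, not a pole of $f_i$, with $y'\neq 0$ and $y''=y'f_i(y)$. Some of the $f_i$ are allowed to be equal. *)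

(* Defs.v *)
From mathcomp Require Import all_boot all_order all_algebra all_field.
From mathcomp Require Import boolp classical_sets functions cardinality reals.
From mathcomp Require Import complex mpoly.

Set Implicit Arguments.
Unset Strict Implicit.
Unset Printing Implicit Defensive.

Import Order.TTheory GRing.Theory Num.Theory.
Local Open Scope classical_set_scope.
Local Open Scope card_scope.
Local Open Scope ring_scope.

Local Notation "x %:F" := (FracField.tofrac x) : ring_scope.

(** * Differential fields *)

Definition is_derivation (U : fieldType) (delta : U -> U) : Prop :=
  (forall x y, delta (x + y) = delta x + delta y) /\
  (forall x y, delta (x * y) = delta x * y + x * delta y).

Definition constants (U : fieldType) (delta : U -> U) : set U :=
  [set u | delta u = 0].

(* A differential polynomial of order < n in one unknown is an element of
   {mpoly U[n]}, its i-th variable standing for the i-th derivative. *)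
Definition deval (U : fieldType) (delta : U -> U) (n : nat)
    (p : {mpoly U[n]}) (x : U) : U :=
  p.@[fun i : 'I_n => iter i delta x].

(* The differential polynomial has order exactly n: its highest variable
   occurs. *)
Definition order_exactly (U : fieldType) (n : nat) (p : {mpoly U[n.+1]}) :
    Prop :=
  exists2 m, m \in msupp p & m ord_max != 0%N.

(* Blum's axioms. Nonzero elements of U have order -1, so that n = 0 says that
   U is algebraically closed. *)
Record is_DCF0 (U : fieldType) (delta : U -> U) : Prop := IsDCF0 {
  DCF0_derivation : is_derivation delta;
  DCF0_char0 : [pchar U] =i pred0;
  DCF0_closed : forall (n : nat) (f : {mpoly U[n.+1]}) (g : {mpoly U[n]}),
    order_exactly f -> g != 0 ->
    exists x, deval delta f x = 0 /\ deval delta g x != 0 }.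

(** * Saturation *)

(* First-order terms and formulas in the language (0, 1, +, -, *, delta) of
   differential rings, with parameters in A and free variables indexed by
   'I_n; a quantifier binds the variable 0, the others being shifted. *)
Inductive dterm (A : Type) (n : nat) : Type :=
| TVar of 'I_n
| TParam of A
| TZero
| TOne
| TAdd of dterm A n & dterm A n
| TOpp of dterm A n
| TMul of dterm A n & dterm A n
| TDer of dterm A n.

Inductive dform (A : Type) : nat -> Type :=
| FEq n of dterm A n & dterm A n : dform A n
| FNot n of dform A n : dform A n
| FAnd n of dform A n & dform A n : dform A n
| FExists n of dform A n.+1 : dform A n.

Section Semantics.
Variables (U : fieldType) (delta : U -> U) (A : Type) (val_A : A -> U).

Fixpoint teval (n : nat) (e : 'I_n -> U) (t : dterm A n) : U :=
  match t with
  | TVar i => e i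
  | TParam a => val_A a
  | TZero => 0
  | TOne => 1
  | TAdd t1 t2 => teval e t1 + teval e t2
  | TOpp t1 => - teval e t1
  | TMul t1 t2 => teval e t1 * teval e t2
  | TDer t1 => delta (teval e t1)
  end.

Definition env_cons (n : nat) (x : U) (e : 'I_n -> U) : 'I_n.+1 -> U :=
  fun i => oapp e x (unlift ord0 i).

Fixpoint fholds (n : nat) (phi : dform A n) : ('I_n -> U) -> Prop :=
  match phi with
  | FEq _ t1 t2 => fun e => teval e t1 = teval e t2
  | FNot _ phi1 => fun e => ~ fholds phi1 e
  | FAnd _ phi1 phi2 => fun e => fholds phi1 e /\ fholds phi2 e
  | FExists _ phi1 => fun e => exists x, fholds phi1 (env_cons x e)
  end.

End Semantics.

(* |U|-saturation: every set of formulas in one variable with fewer than |U|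
   parameters, finitely satisfiable in U, is realized in U. *)
Definition is_saturated (U : fieldType) (delta : U -> U) : Prop :=
  forall A : set U, ~~ ([set: U] #<= A) ->
  forall p : set (dform A 1),
    (forall F : set (dform A 1), finite_set F -> F `<=` p ->
       exists x : U, forall phi, F phi ->
         fholds delta (fun a : A => set_val a) phi (fun=> x)) ->
    exists x : U, forall phi, p phi ->
      fholds delta (fun a : A => set_val a) phi (fun=> x).

(** * Rational functions *)

(* Numerator and denominator in lowest terms; [repr] only chooses some
   representative of the fraction. *)
Definition rat_num (k : fieldType) (f : {fraction {poly k}}) : {poly k} :=
  let r := repr f in \n_r %/ gcdp \n_r \d_r.

Definition rat_den (k : fieldType) (f : {fraction {poly k}}) : {poly k} :=
  let r := repr f in \d_r %/ gcdp \n_r \d_r.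

Definition rat_deriv (k : fieldType) (f : {fraction {poly k}}) :
    {fraction {poly k}} :=
  ((rat_num f)^`() * rat_den f - rat_num f * (rat_den f)^`())%:F
    / (rat_den f ^+ 2)%:F.

(* f(a z + b); only meaningful for a != 0. *)
Definition rat_affine (k : fieldType) (f : {fraction {poly k}}) (a b : k) :
    {fraction {poly k}} :=
  (rat_num f \Po (a *: 'X + b%:P))%:F / (rat_den f \Po (a *: 'X + b%:P))%:F.

Definition is_pole (k K : fieldType) (iota : k -> K) (f : {fraction {poly k}})
    (x : K) : Prop :=
  (map_poly iota (rat_den f)).[x] = 0.

Definition rat_eval (k K : fieldType) (iota : k -> K)
    (f : {fraction {poly k}}) (x : K) : K :=
  (map_poly iota (rat_num f)).[x] / (map_poly iota (rat_den f)).[x].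

(* y'' / y' = f(y). *)
Definition is_solution (k U : fieldType) (delta : U -> U) (iota : k -> U)
    (f : {fraction {poly k}}) (y : U) : Prop :=
  [/\ ~ is_pole iota f y, delta y != 0 &
      delta (delta y) = delta y * rat_eval iota f y].

(** * Transcendence degree *)

Definition adjoin (k U : fieldType) (iota : k -> U) (S : set U) : set U :=
  smallest [set K : set U | GRing.divring_closed [pred x in K]] (range iota `|` S).

Definition alg_independent (k U : fieldType) (iota : {rmorphism k -> U})
    (d : nat) (b : 'I_d -> U) : Prop :=
  forall p : {mpoly k[d]}, p != 0 -> mmap iota b p != 0.

Definition algebraic_over (U : fieldType) (K : set U) (x : U) : Prop :=
  exists p : {poly U}, [/\ p != 0, (forall i, K p`_i) & root p x].

(* L has a transcendence basis over iota(k) with d elements. *)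
Definition has_trdeg (k U : fieldType) (iota : {rmorphism k -> U})
    (L : set U) (d : nat) : Prop :=
  exists b : 'I_d -> U,
    [/\ (forall i, L (b i)), alg_independent iota b &
        forall x, L x -> algebraic_over (adjoin iota (range b)) x].

(* Main.v *)
Require Import Defs.
From mathcomp Require Import all_boot all_order all_algebra all_field.
From mathcomp Require Import boolp classical_sets functions cardinality reals.
From mathcomp Require Import complex mpoly.
From mathcomp Require Import ring zify.

(** Algebraic dependence is studied through derivations of [U] rather than
through differential forms. In characteristic 0 an element is algebraic over
the field generated by a set [S] if and only if every derivation of [U] that
kills [S] kills it. Half of this serves as the definition of the closure
[dcl S]: monotonicity, exchange and stability under [delta] then become linear
algebra in the space of derivations. The other half, [dcl_algebraic], gives
back minimal polynomials when they are needed.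

The obstruction that carries the theorem is [not_log_exact]. Let [K] be a field
containing the constants, [x] transcendental over [K], [d] the derivation d/dx
over [K], and [E] a derivation that preserves [K], kills the constants and
kills [x]. If [f] is not the derivative of a rational function, then [f(x)] is
not of the form [E p / p + d r] with [p] and [r] algebraic over [K(x)]. Indeed,
taking traces ([log_trace]) replaces [p] and [r] by elements of [K(x)] and
multiplies [f] by a positive integer. By partial fractions [f] has a nonzero
residue at some constant [a]; but [d r] has no residue anywhere, and
[E p / p] has no pole at [a] because [E (x - a) = 0].

Let [K] be a field closed under [dcl] and [delta] and containing the constants,
let [x] outside [K] be a solution for [f], and put [z = x']. If [z] were
algebraic over [K(x)], then [E = delta - z d] would satisfy
[f(x) = E z / z + d z], which is impossible; so [x] and [x'] are algebraically
independent over [K] ([solution_transcendental]).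

Let moreover [w] outside [K] be a solution for [g] that is algebraic over
[K(x, x')], and put [q = w']. Suppose that [w] is not algebraic over [K(x)].
Then [x] and [w] are independent coordinates, of which [z] and [q] are
algebraic functions. The 2-forms dx dz / z and dw dq / q are both invariant
under [delta], because the contraction of
dx dz / z with [delta] is the closed form dz - f(x) dx; hence their ratio, which up to sign is
[kappa = (q_x / q) / (z_w / z)], is a constant. With
[E = delta - z d/dx - q d/dw] the equation for [z] becomes
[f(x) = E z / z + d/dx (z + q / kappa)], which is impossible
([exchange_solution]). So [w] is algebraic over [K(x)]. Then [w'' = w' g(w)] is
a polynomial identity in the transcendental [z]; its coefficients give
[w = alpha x + beta] with [alpha] and [beta] in [K] and
[g(w) = f(x) + 2 alpha' / alpha], and comparing residues shows that [alpha] and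
[beta] are constants ([affine_solution]).

An induction on the number of solutions now shows that, in the absence of
affine relations, no [y_i] is algebraic over the field generated by the
constants, any of the other solutions and their derivatives ([solution_notin_dcl]). Together with the
independence of [x] and [x'], this says that each term of the sequence
y_0, y_0', y_1, y_1', ... lies outside the closure of the previous ones. *)

Import Order.TTheory GRing.Theory Num.Theory.
Local Open Scope classical_set_scope.
Local Open Scope ring_scope.

Set Implicit Arguments.
Unset Strict Implicit.
Unset Printing Implicit Defensive.

(** * Derivations *)

Section Derivations.
Variables (U : fieldType) (D : U -> U) (derD : is_derivation D).

Lemma derD_ x y : D (x + y) = D x + D y. Proof. exact: derD.1. Qed.
Lemma derM x y : D (x * y) = D x * y + x * D y. Proof. exact: derD.2. Qed.

Lemma der0 : D 0 = 0.
Proof. by apply: (addrI (D 0)); rewrite -derD_ !addr0. Qed.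

Lemma der1 : D 1 = 0.
Proof.
by apply: (addrI (D 1)); rewrite -{2}[D 1]mulr1 -{1}[D 1]mul1r addr0 addrC
  -derM mulr1.
Qed.

Lemma derN x : D (- x) = - D x.
Proof. by apply/eqP; rewrite -subr_eq0 opprK addrC -derD_ subrr der0. Qed.

Lemma derB x y : D (x - y) = D x - D y.
Proof. by rewrite derD_ derN. Qed.

Lemma der_sum (I : Type) (s : seq I) (F : I -> U) :
  D (\sum_(i <- s) F i) = \sum_(i <- s) D (F i).
Proof. exact: (big_morph D derD_ der0). Qed.

Lemma der_nat n : D n%:R = 0.
Proof. by elim: n => [|n IH]; rewrite ?der0 // -addn1 natrD derD_ IH der1 addr0. Qed.

Lemma derXn x n : D (x ^+ n) = n%:R * x ^+ n.-1 * D x.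
Proof.
elim: n => [|n IH]; first by rewrite expr0 der1 !mul0r.
rewrite exprS derM IH /=; case: n {IH} => [|n] /=.
  by rewrite expr0 !(mul0r, mulr0, mulr1, mul1r) addr0.
by rewrite -[n.+2]addn1 natrD exprS; ring.
Qed.

Lemma derV x : D x^-1 = - D x / x ^+ 2.
Proof.
have [->|x0] := eqVneq x 0; first by rewrite invr0 der0 oppr0 mul0r.
have: D (x * x^-1) = 0 by rewrite divff // der1.
rewrite derM => /eqP; rewrite addrC addr_eq0 => /eqP h.
apply: (mulfI x0); rewrite h; field; exact: x0.
Qed.

Lemma der_div x y : y != 0 -> D (x / y) = (D x * y - x * D y) / y ^+ 2.
Proof. by move=> y0; rewrite derM derV; field. Qed.

Lemma coef_map_der (p : {poly U}) i : (map_poly D p)`_i = D p`_i.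
Proof. exact: coef_map_id0 der0. Qed.

Lemma der_horner (p : {poly U}) x :
  D p.[x] = (map_poly D p).[x] + p^`().[x] * D x.
Proof.
elim/poly_ind: p => [|p c IH].
  by rewrite (_ : map_poly D 0 = 0) ?deriv0 ?horner0 ?der0 ?mul0r ?addr0 //;
     apply/polyP=> i; rewrite coef_map_der !coef0 der0.
have -> : map_poly D (p * 'X + c%:P) = map_poly D p * 'X + (D c)%:P.
  apply/polyP=> i; rewrite coef_map_der !coefD !coefMX !coefC derD_ coef_map_der.
  by case: i => [|i] /=; rewrite ?der0.
rewrite derivD derivM derivX derivC !hornerE derD_ derM IH; ring.
Qed.

End Derivations.

Lemma der_comb (U : fieldType) (D1 D2 : U -> U) (c : U) :
  is_derivation D1 -> is_derivation D2 ->
  is_derivation (fun u => D1 u - c * D2 u).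
Proof.
move=> h1 h2; split=> x y.
  by rewrite (derD_ h1) (derD_ h2); ring.
by rewrite (derM h1) (derM h2); ring.
Qed.

Lemma der_commutator (U : fieldType) (D1 D2 : U -> U) :
  is_derivation D1 -> is_derivation D2 ->
  is_derivation (fun u => D1 (D2 u) - D2 (D1 u)).
Proof.
move=> h1 h2; split=> x y.
  by rewrite (derD_ h1) (derD_ h2) (derD_ h1) (derD_ h2); ring.
rewrite (derM h2) (derM h1) !(derD_ h1) !(derD_ h2).
by rewrite !(derM h1) !(derM h2); ring.
Qed.

(** * Subrings and subfields *)

Record subring (U : fieldType) (M : set U) : Prop := Subring {
  subring1 : M 1;
  subringB : forall a b, M a -> M b -> M (a - b);
  subringM : forall a b, M a -> M b -> M (a * b) }.

Definition subfield (U : fieldType) (M : set U) : Prop :=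
  subring M /\ forall a, M a -> M a^-1.

(** Polynomials are kept in [{poly U}] with their coefficients in a set, so that
several subfields of [U] can be compared without changing types. *)
Definition poly_over (U : fieldType) (M : set U) (p : {poly U}) : Prop :=
  forall i, M p`_i.

Section Subring.
Variables (U : fieldType) (M : set U) (ringM : subring M).

Lemma subring0 : M 0.
Proof. by rewrite -(subrr 1); apply: (subringB ringM); exact: subring1. Qed.

Lemma subringN a : M a -> M (- a).
Proof. by move=> Ma; rewrite -sub0r; apply: (subringB ringM) => //; exact: subring0. Qed.

Lemma subringD a b : M a -> M b -> M (a + b).
Proof.
by move=> Ma Mb; rewrite -(opprK b); apply: (subringB ringM) => //; exact: subringN.
Qed.

Lemma subring_sum (I : Type) (r : seq I) (P : pred I) (F : I -> U) :
  (forall i, P i -> M (F i)) -> M (\sum_(i <- r | P i) F i).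
Proof. by move=> h; elim/big_rec: _ => [|i x /h ? ?]; [exact: subring0|exact: subringD]. Qed.

Lemma subring_nat n : M n%:R.
Proof.
elim: n => [|n IH]; first exact: subring0.
by rewrite -addn1 natrD; apply: subringD => //; exact: subring1.
Qed.

Lemma subringX a n : M a -> M (a ^+ n).
Proof.
move=> Ma; elim: n => [|n IH]; first by rewrite expr0; exact: subring1.
by rewrite exprS; apply: (subringM ringM).
Qed.

Lemma poly_overC c : M c -> poly_over M c%:P.
Proof. by move=> Mc i; rewrite coefC; case: ifP => _ //; exact: subring0. Qed.

Lemma poly_overX : poly_over M 'X.
Proof. by move=> i; rewrite coefX; exact: subring_nat. Qed.

Lemma poly_overXn n : poly_over M 'X^n.
Proof. by move=> i; rewrite coefXn; exact: subring_nat. Qed.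

Lemma poly_overB p q : poly_over M p -> poly_over M q -> poly_over M (p - q).
Proof. by move=> hp hq i; rewrite coefB; apply: (subringB ringM). Qed.

Lemma poly_overD p q : poly_over M p -> poly_over M q -> poly_over M (p + q).
Proof. by move=> hp hq i; rewrite coefD; apply: subringD. Qed.

Lemma poly_overM p q : poly_over M p -> poly_over M q -> poly_over M (p * q).
Proof.
by move=> hp hq i; rewrite coefM; apply: subring_sum => j _; apply: (subringM ringM).
Qed.

Lemma poly_overZ c p : M c -> poly_over M p -> poly_over M (c *: p).
Proof. by move=> Mc hp i; rewrite coefZ; apply: (subringM ringM). Qed.

Lemma poly_over_deriv p : poly_over M p -> poly_over M p^`().
Proof.
move=> hp i; rewrite coef_deriv -mulr_natr.
by apply: (subringM ringM) => //; exact: subring_nat.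
Qed.

Lemma poly_over_map D p : is_derivation D -> (forall a, M a -> M (D a)) ->
  poly_over M p -> poly_over M (map_poly D p).
Proof. by move=> derD MD hp i; rewrite (coef_map_der derD); apply: MD. Qed.

Lemma subring_horner p x : poly_over M p -> M x -> M p.[x].
Proof.
move=> hp Mx; rewrite horner_coef; apply: subring_sum => i _.
by apply: (subringM ringM) => //; exact: subringX.
Qed.

End Subring.

(** * Derivational closure *)

Section Closure.
Variable U : fieldType.
Implicit Types (S T : set U) (D : U -> U).

Definition kills D S : Prop := forall s, S s -> D s = 0.

(** In characteristic 0 this is the relative algebraic closure in [U] of the
field generated by [S]. *)
Definition dcl S : set U :=
  [set u | forall D, is_derivation D -> kills D S -> D u = 0].

Lemma sub_dcl S : S `<=` dcl S.
Proof. by move=> s Ss D _; apply. Qed.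

Lemma dcl_idem S T : T `<=` dcl S -> dcl T `<=` dcl S.
Proof. by move=> TS u uT D derD DS; apply: uT => // t /TS; apply. Qed.

Lemma dclS S T : S `<=` T -> dcl S `<=` dcl T.
Proof. by move=> ST; apply: dcl_idem => s /ST; exact: sub_dcl. Qed.

Lemma dcl_subfield S : subfield (dcl S).
Proof.
split; [split|].
- by move=> D derD _; exact: der1.
- by move=> a b Sa Sb D derD DS; rewrite (derB derD) (Sa D) // (Sb D) // subrr.
- by move=> a b Sa Sb D derD DS; rewrite (derM derD) (Sa D) // (Sb D) // mul0r mulr0 addr0.
- by move=> a Sa D derD DS; rewrite (derV derD) (Sa D) // oppr0 mul0r.
Qed.

(** Subtracting from a derivation a multiple of one that moves [u] corrects its
value at [v] to 0. *)
Lemma dcl_exchange S u v : dcl (v |` S) u -> ~ dcl S u -> dcl (u |` S) v.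
Proof.
move=> uSv uS D derD DuS.
move: uS => /existsNP [D0] /not_implyP [derD0] /not_implyP [D0S D0u].
have D0v : D0 v != 0.
  by apply/eqP => D0v; apply: D0u; apply: uSv => // s [->|/D0S].
have /eqP : D u - D v / D0 v * D0 u = 0.
  apply: (uSv _ (der_comb (D v / D0 v) derD derD0)) => s [->|Ss].
    by field.
  by rewrite (D0S s) // (DuS s) ?mulr0 ?subr0 //; right.
rewrite (DuS u) ?sub0r; last by left.
rewrite oppr_eq0 mulf_eq0 mulf_eq0 invr_eq0 (negPf D0v) orbF.
by move=> /orP[/eqP //|/eqP].
Qed.

(** The commutator of [D] with a derivation killing [S] kills [S] again. *)
Lemma dcl_stable S D : is_derivation D -> (forall s, S s -> dcl S (D s)) ->
  forall u, dcl S u -> dcl S (D u).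
Proof.
move=> derD DS u uS D' derD' D'S.
have := uS _ (der_commutator derD' derD); rewrite (uS D') // (der0 derD) subr0.
by apply=> s Ss; rewrite (DS _ Ss) // (D'S s) // (der0 derD) subrr.
Qed.

End Closure.

(** * Extending derivations *)

Section Extension.
Variable U : fieldType.
Hypothesis char0 : [pchar U] =i pred0.

Lemma natr_neq0 n : (n.+1%:R : U) != 0.
Proof. by move/pcharf0P: char0 => ->. Qed.

(** The graph of a derivation defined on a subring of [U]. A pair [(a, a')]
stands for the dual number a + a' eps, so such a graph is a subring of the dual
numbers over [U] meeting the line of multiples of eps in 0. Graphs are used
because unions of chains of partial derivations are unions of sets. *)
Record der_graph (G : set (U * U)) : Prop := DerGraph {
  graph1 : G (1, 0);
  graphB : forall a b, G a -> G b -> G (a.1 - b.1, a.2 - b.2);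
  graphM : forall a b, G a -> G b -> G (a.1 * b.1, a.2 * b.1 + a.1 * b.2);
  graph_fun : forall c, G (0, c) -> c = 0 }.

(** [(P, Q)] is the polynomial P + Q eps over the dual numbers. *)
Definition pair_over (G : set (U * U)) (P Q : {poly U}) : Prop :=
  forall i, G (P`_i, Q`_i).

Section Graph.
Variables (G : set (U * U)) (graphG : der_graph G).

Lemma graph0 : G (0, 0).
Proof. by have := graphB graphG (graph1 graphG) (graph1 graphG); rewrite /= !subrr. Qed.

Lemma graphD a b : G a -> G b -> G (a.1 + b.1, a.2 + b.2).
Proof.
move=> Ga Gb; have := graphB graphG Ga (graphB graphG graph0 Gb).
by rewrite /= !sub0r !opprK.
Qed.

Lemma graph_sum (I : Type) (r : seq I) (F F' : I -> U) :
  (forall i, G (F i, F' i)) -> G (\sum_(i <- r) F i, \sum_(i <- r) F' i).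
Proof.
move=> h; elim: r => [|i r IH]; first by rewrite !big_nil; exact: graph0.
by rewrite !big_cons; exact: (graphD (h i) IH).
Qed.

Lemma graphMn a a' n : G (a, a') -> G (a *+ n, a' *+ n).
Proof.
move=> Ga; elim: n => [|n IH]; first exact: graph0.
by rewrite !mulrSr; exact: (graphD IH Ga).
Qed.

Lemma pair_overB P Q R S :
  pair_over G P Q -> pair_over G R S -> pair_over G (P - R) (Q - S).
Proof. by move=> h h' i; rewrite !coefB; exact: (graphB graphG (h i) (h' i)). Qed.

Lemma pair_overM P Q R S : pair_over G P Q -> pair_over G R S ->
  pair_over G (P * R) (Q * R + P * S).
Proof.
move=> h h' i; rewrite coefD !coefM -big_split.
by apply: graph_sum => j; exact: (graphM graphG (h j) (h' _)).
Qed.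

Lemma pair_overC a a' : G (a, a') -> pair_over G a%:P a'%:P.
Proof. by move=> Ga [|i]; rewrite !coefC //=; exact: graph0. Qed.

Lemma pair_overX : pair_over G 'X 0.
Proof.
by move=> i; rewrite coef0 coefX; case: eqP => _; [exact: graph1|exact: graph0].
Qed.

Lemma pair_overXn n : pair_over G 'X^n 0.
Proof.
elim: n => [|n IH]; first exact: pair_overC (graph1 graphG).
by have := pair_overM pair_overX IH; rewrite mul0r mulr0 addr0 -exprS.
Qed.

Lemma pair_over_deriv P Q : pair_over G P Q -> pair_over G P^`() Q^`().
Proof. by move=> h i; rewrite !coef_deriv; apply: graphMn. Qed.

(** The eps-part of the value of P + Q eps at v + c eps. *)
Definition pair_val (v c : U) (P Q : {poly U}) : U := Q.[v] + P^`().[v] * c.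

Lemma pair_valM v c P Q R S :
  pair_val v c (P * R) (Q * R + P * S) =
  pair_val v c P Q * R.[v] + P.[v] * pair_val v c R S.
Proof. by rewrite /pair_val derivM !hornerE; ring. Qed.

Lemma pair_valB v c P Q R S :
  pair_val v c (P - R) (Q - S) = pair_val v c P Q - pair_val v c R S.
Proof. by rewrite /pair_val derivB !hornerE; ring. Qed.

Definition graph_adjoin (v c : U) : set (U * U) :=
  [set w | exists P Q, pair_over G P Q /\ w = (P.[v], pair_val v c P Q)].

Lemma graph_adjoinP v c :
  (forall P Q, pair_over G P Q -> P.[v] = 0 -> pair_val v c P Q = 0) ->
  [/\ der_graph (graph_adjoin v c), G `<=` graph_adjoin v c &
      graph_adjoin v c (v, c)].
Proof.
move=> compat; split.
- split.
  + exists 1, 0; split; first exact: pair_overC (graph1 graphG).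
    by rewrite /pair_val !hornerE derivC !hornerE.
  + move=> _ _ [P [Q [PQ ->]]] [R [S [RS ->]]]; exists (P - R), (Q - S).
    by split; [exact: pair_overB|rewrite pair_valB !hornerE].
  + move=> _ _ [P [Q [PQ ->]]] [R [S [RS ->]]]; exists (P * R), (Q * R + P * S).
    by split; [exact: pair_overM|rewrite pair_valM hornerM].
  + by move=> b [P [Q [PQ [Pv ->]]]]; apply: compat.
- move=> [a a'] Ga; exists a%:P, a'%:P; split; first exact: pair_overC.
  by rewrite /pair_val derivC !hornerE.
- exists 'X, 0; split; first exact: pair_overX.
  by rewrite /pair_val derivX !hornerE.
Qed.

(** If [v] is transcendental over the domain, any value [c] is allowed. If it is
algebraic, [c] is dictated by a polynomial [P] of least size vanishing at [v],
whose derivative does not vanish at [v] in characteristic 0; pseudo-division by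
[P] shows that every other vanishing polynomial imposes the same value. *)
Lemma graph_extend v : exists c,
  forall P Q, pair_over G P Q -> P.[v] = 0 -> pair_val v c P Q = 0.
Proof.
pose vanish n := exists P Q,
  [/\ pair_over G P Q, P.[v] = 0, P != 0 & size P = n].
have [[n vn]|none] := pselect (exists n, vanish n); last first.
  exists 0 => P Q PQ Pv; have [P0|P0] := eqVneq P 0; last first.
    by case: none; exists (size P), P, Q.
  have -> : Q = 0.
    apply/polyP=> i; rewrite coef0; apply: (graph_fun graphG).
    by have := PQ i; rewrite P0 coef0.
  by rewrite P0 /pair_val derivC !hornerE.
have [m [P [Q [PQ Pv P0 sP]]] mmin] :
    exists2 m, vanish m & forall k, vanish k -> (m <= k)%N.
  have exb : exists n, `[<vanish n>] by exists n; apply/asboolP.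
  case: (ex_minnP exb) => m /asboolP vm hm.
  by exists m => // k vk; apply: hm; apply/asboolP.
have P'v : P^`().[v] != 0.
  apply/eqP => P'v0; have sP1 : (1 < size P)%N.
    rewrite ltnNge; apply/negP => /size1_polyC Pc.
    by move: Pv P0; rewrite Pc hornerC polyC_eq0 => ->; rewrite eqxx.
  have P'0 : P^`() != 0.
    apply/eqP => /polyP/(_ (size P).-2); rewrite coef0 coef_deriv.
    have -> : (size P).-2.+1 = (size P).-1 by lia.
    move=> /eqP; rewrite -mulr_natr mulf_eq0 -/(lead_coef P) lead_coef_eq0 (negPf P0) /=.
    by move: sP1; case: (size P) => [|[|k]] // _; rewrite (negPf (natr_neq0 _)).
  have: (m <= size P^`())%N.
    by apply: mmin; exists P^`(), Q^`(); split=> //; exact: pair_over_deriv.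
  by rewrite -sP leqNgt lt_size_deriv.
exists (- Q.[v] / P^`().[v]) => R S RS Rv; set c := _ / _.
have valP : pair_val v c P Q = 0 by rewrite /pair_val /c; field.
have [k] := ubnP (size R); elim: k R S RS Rv => // k IH R S RS Rv sR.
have [R0|R0] := eqVneq R 0.
  have -> : S = 0.
    apply/polyP=> i; rewrite coef0; apply: (graph_fun graphG).
    by have := RS i; rewrite R0 coef0.
  by rewrite R0 /pair_val derivC !hornerE.
have sPR : (size P <= size R)%N by rewrite sP; apply: mmin; exists R, S.
have lP0 : lead_coef P != 0 by rewrite lead_coef_eq0.
(* One step of pseudo-division of (R, S) by (P, Q). *)
pose d := (size R - size P)%N.
have h1 := pair_overM (pair_overC (PQ (size P).-1)) RS.
have h2 := pair_overM (pair_overM (pair_overC (RS (size R).-1)) (pair_overXn d)) PQ.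
rewrite mulr0 addr0 in h2.
have h := pair_overB h1 h2.
have small : (size ((P`_(size P).-1)%:P * R - (R`_(size R).-1)%:P * 'X^d * P)%R < k)%N.
  rewrite ltnS in sR; apply: leq_trans sR.
  have R1 : (0 < size R)%N by rewrite size_poly_gt0.
  rewrite -[X in (_ < X)%N](prednK R1) ltnS.
  apply/leq_sizeP => j hj; rewrite coefB -mulrA !mul_polyC !coefZ coefXnM.
  have P1 : (0 < size P)%N by rewrite size_poly_gt0.
  have -> : (j < d)%N = false by apply/negbTE; rewrite -leqNgt /d; lia.
  have [->|jn] := eqVneq j (size R).-1.
    have -> : ((size R).-1 - d)%N = (size P).-1 by rewrite /d; lia.
    by rewrite mulrC subrr.
  have jR : (size R <= j)%N by rewrite -(prednK R1) ltn_neqAle eq_sym jn.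
  have -> : R`_j = 0 by apply: nth_default.
  have -> : P`_(j - d) = 0.
    by apply: nth_default; rewrite leq_subRL ?subnK // (leq_trans (leq_subr _ _)).
  by rewrite !mulr0 subrr.
have := IH _ _ h _ small.
rewrite pair_valB !pair_valM valP mulr0 addr0 !hornerE Pv Rv !mulr0 oppr0 !addr0 !add0r.
by move=> /(_ erefl)/eqP; rewrite mulf_eq0 (negPf lP0) => /eqP.
Qed.

End Graph.

(** By Zorn's lemma the derivation [d/du] of [M[u]] has a maximal extension, and
by [graph_extend] its domain is [U]. *)
Lemma der_adjoin (M : set U) (u : U) : subring M ->
  (forall P, poly_over M P -> P.[u] = 0 -> P = 0) ->
  exists D, [/\ is_derivation D, kills D M & D u = 1].
Proof.
move=> ringM utr.
pose G0 : set (U * U) := [set w | M w.1 /\ w.2 = 0].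
have graphG0 : der_graph G0.
  split; rewrite /G0 /=.
  - by split=> //; exact: subring1.
  - by move=> [a a'] [b b'] /= [Ma ->] [Mb ->]; rewrite subrr; split=> //; exact: subringB.
  - move=> [a a'] [b b'] /= [Ma ->] [Mb ->]; rewrite mul0r mulr0 addr0; split=> //.
    exact: subringM.
  - by move=> c [].
have [|graphG1 G01 G1u] := @graph_adjoinP G0 graphG0 u 1.
  move=> P Q PQ Pu; have -> : P = 0 by apply: utr => // i; exact: (PQ i).1.
  have -> : Q = 0 by apply/polyP=> i; rewrite coef0; exact: (PQ i).2.
  by rewrite /pair_val derivC !hornerE.
set G1 := graph_adjoin G0 u 1 in graphG1 G01 G1u.
(* The empty set is admitted for the sake of the empty chain. *)
pose good (G : set (U * U)) := G = set0 \/ (der_graph G /\ G1 `<=` G).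
have [F goodF totF|A [goodA maxA]] := @Zorn_bigcup _ good.
  have [[G [FG G0_]]|none] := pselect (exists G, F G /\ G <> set0); last first.
    left; apply/seteqP; split=> // w [G FG Gw]; apply: none; exists G; split=> //.
    by move=> G0_; rewrite G0_ in Gw.
  have gr H w : F H -> H w -> der_graph H /\ G1 `<=` H.
    by move=> /goodF [->|].
  have two a b : (\bigcup_(X in F) X) a -> (\bigcup_(X in F) X) b ->
      exists H, [/\ F H, der_graph H, H a & H b].
    move=> [H FH Ha] [H' FH' H'b]; have [HH'|HH'] := totF _ _ FH FH'.
      by exists H'; split=> //; [have [] := gr _ _ FH' H'b|exact: HH'].
    by exists H; split=> //; [have [] := gr _ _ FH Ha|exact: HH'].
  have [//|[graphG G1G]] := goodF _ FG.
  right; split; last by move=> w /G1G Gw; exists G.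
  split.
  - by exists G => //; exact: graph1.
  - by move=> a b /two h /h [H [FH gH Ha Hb]]; exists H => //; exact: graphB.
  - by move=> a b /two h /h [H [FH gH Ha Hb]]; exists H => //; exact: graphM.
  - by move=> c [H FH Hc]; have [gH _] := gr _ _ FH Hc; exact: (graph_fun gH).
have [graphA G1A] : der_graph A /\ G1 `<=` A.
  case: goodA => // A0; case: (maxA G1); last by right; split.
  by rewrite A0; split; [exact: sub0set|move=> /(_ _ G1u)].
have domA v : exists c, A (v, c).
  have [c hc] := graph_extend graphA v; exists c.
  have [gA' AA' A'v] := graph_adjoinP graphA hc.
  apply: contrapT => nAv; apply: (maxA (graph_adjoin A v c)).
    by split=> // /(_ _ A'v).
  by right; split=> // w /G1A/AA'.
have [D DA] := choice domA.
have uniq v c : A (v, c) -> D v = c.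
  move=> Avc; have := graphB graphA (DA v) Avc; rewrite /= subrr => /(graph_fun graphA).
  by move/eqP; rewrite subr_eq0 => /eqP.
exists D; split.
- split=> a b; apply: uniq.
    exact: (graphD graphA (DA a) (DA b)).
  exact: (graphM graphA (DA a) (DA b)).
- by move=> m Mm; apply: uniq; apply: G1A; apply: G01.
- by apply: uniq; apply: G1A.
Qed.

Lemma dcl_algebraic (M : set U) (u : U) : subring M -> dcl M u ->
  exists P, [/\ poly_over M P, P != 0 & P.[u] = 0].
Proof.
move=> ringM uM; apply: contrapT => none.
have [P MP Pu|D [derD DM Du]] := @der_adjoin M u ringM.
  by apply: contrapT => /eqP P0; apply: none; exists P.
by have := uM _ derD DM; rewrite Du => /eqP; rewrite oner_eq0.
Qed.

End Extension.

(** * Simple extensions, minimal polynomials and traces *)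

Section Extensions.
Variable U : fieldType.
Hypothesis char0 : [pchar U] =i pred0.

(** The field [K(x)]. *)
Definition frac_ext (K : set U) (x : U) : set U :=
  [set m | exists a b, [/\ poly_over K a, poly_over K b, b.[x] != 0 &
                           m = a.[x] / b.[x]]].

(** The ring [M[p]], a field when [p] is algebraic over the field [M]. *)
Definition ring_ext (M : set U) (p : U) : set U :=
  [set m | exists2 R, poly_over M R & m = R.[p]].

Section FracExt.
Variables (K : set U) (x : U) (ringK : subring K).

Lemma frac_ext_horner a : poly_over K a -> frac_ext K x a.[x].
Proof.
move=> Ka; exists a, 1; rewrite hornerC divr1 oner_eq0; split=> //.
exact: poly_overC (subring1 ringK).
Qed.

Lemma frac_ext_base c : K c -> frac_ext K x c.
Proof. by move=> Kc; rewrite -(hornerC c x); apply: frac_ext_horner; exact: poly_overC. Qed.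

Lemma frac_ext_gen : frac_ext K x x.
Proof. by rewrite -{2}(hornerX x); apply: frac_ext_horner; exact: poly_overX. Qed.

Lemma frac_ext_subfield : subfield (frac_ext K x).
Proof.
split; [split|].
- exact: frac_ext_base (subring1 ringK).
- move=> _ _ [a [b [Ka Kb b0 ->]]] [c [d [Kc Kd d0 ->]]].
  exists (a * d - c * b), (b * d); rewrite !hornerE mulf_neq0 //; split=> //.
  + by apply: (poly_overB ringK); exact: poly_overM.
  + exact: poly_overM.
  + by field; rewrite b0 d0.
- move=> _ _ [a [b [Ka Kb b0 ->]]] [c [d [Kc Kd d0 ->]]].
  exists (a * c), (b * d); rewrite !hornerM mulf_neq0 //; split=> //.
  + exact: poly_overM.
  + exact: poly_overM.
  + by field; rewrite b0 d0.
- move=> _ [a [b [Ka Kb b0 ->]]]; have [a0|a0] := eqVneq a.[x] 0.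
    by rewrite a0 mul0r invr0; exact: frac_ext_base (subring0 ringK).
  by exists b, a; rewrite invf_div.
Qed.

Lemma frac_ext_stable D : is_derivation D -> (forall c, K c -> K (D c)) ->
  frac_ext K x (D x) -> forall m, frac_ext K x m -> frac_ext K x (D m).
Proof.
move=> derD DK Dx _ [a [b [Ka Kb b0 ->]]].
have [ringKx invKx] := frac_ext_subfield.
have Dh c : poly_over K c -> frac_ext K x (D c.[x]).
  move=> Kc; rewrite (der_horner derD); apply: (subringD ringKx).
    by apply: frac_ext_horner; exact: poly_over_map.
  apply: (subringM ringKx) => //; apply: frac_ext_horner.
  exact: poly_over_deriv.
rewrite (der_div derD) //; apply: (subringM ringKx).
  by apply: (subringB ringKx); apply: (subringM ringKx); try exact: Dh; exact: frac_ext_horner.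
by apply: invKx; apply: subringX => //; exact: frac_ext_horner.
Qed.

End FracExt.

Lemma poly_over_edivp (M : set U) P Q : subring M ->
  poly_over M P -> P \is monic -> poly_over M Q ->
  exists A B, [/\ poly_over M A, poly_over M B, Q = A * P + B &
                  (size B < size P)%N].
Proof.
move=> ringM MP monP; have [k] := ubnP (size Q); elim: k Q => // k IH Q sQ MQ.
have P1 : (0 < size P)%N by rewrite size_poly_gt0 monic_neq0.
have [lt|le] := ltnP (size Q) (size P).
  exists 0, Q; split=> //; last by rewrite mul0r add0r.
  by apply: poly_overC => //; exact: subring0.
have Q1 : (0 < size Q)%N by apply: leq_trans le.
pose A0 := lead_coef Q *: 'X^(size Q - size P) : {poly U}.
have MA0 : poly_over M A0.
  by apply: (poly_overZ ringM); [exact: MQ|exact: poly_overXn].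
have [||A [B [MA MB eQ sB]]] := IH (Q - A0 * P).
- rewrite ltnS in sQ; apply: leq_trans sQ.
  rewrite -[X in (_ < X)%N](prednK Q1) ltnS.
  apply/leq_sizeP => j hj; rewrite coefB -scalerAl coefZ coefXnM.
  have -> : (j < size Q - size P)%N = false.
    apply/negbTE; rewrite -leqNgt (leq_trans _ hj) //.
    by rewrite -ltnS (prednK Q1) -subSn // leq_subLR -[X in (X <= _)%N]add1n leq_add2r.
  have [->|jn] := eqVneq j (size Q).-1.
    have -> : ((size Q).-1 - (size Q - size P))%N = (size P).-1.
      by move: P1 le; generalize (size P) (size Q) => *; lia.
    by rewrite -/(lead_coef P) (monicP monP) mulr1 subrr.
  have jQ : (size Q <= j)%N by rewrite -(prednK Q1) ltn_neqAle eq_sym jn.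
  have -> : Q`_j = 0 by apply: nth_default.
  have -> : P`_(j - (size Q - size P)) = 0.
    by apply: nth_default; rewrite leq_subRL ?subnK // (leq_trans (leq_subr _ _)).
  by rewrite mulr0 subrr.
- by apply: (poly_overB ringM) => //; exact: poly_overM.
exists (A + A0), B; split=> //; first exact: poly_overD.
by rewrite mulrDl addrAC -eQ subrK.
Qed.

Lemma der_root (D : U -> U) (u : U) (P : {poly U}) : is_derivation D -> P.[u] = 0 ->
  D u * P^`().[u] = - (map_poly D P).[u].
Proof.
move=> derD Pu; have := der_horner derD P u; rewrite Pu (der0 derD) => /esym/eqP.
by rewrite addrC addr_eq0 mulrC => /eqP.
Qed.

Record minpoly (M : set U) (u : U) (P : {poly U}) : Prop := Minpoly {
  minpoly_over : poly_over M P;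
  minpoly_monic : P \is monic;
  minpoly_root : P.[u] = 0;
  minpoly_min : forall Q, poly_over M Q -> Q.[u] = 0 ->
    (size Q < size P)%N -> Q = 0 }.

Section MinPoly.
Variables (M : set U) (fieldM : subfield M).
Let ringM := fieldM.1.

Lemma minpoly_ex u : dcl M u -> exists P, minpoly M u P.
Proof.
move=> uM; pose vanish n := exists P,
  [/\ poly_over M P, P != 0, P.[u] = 0 & size P = n].
have exb : exists n, `[<vanish n>].
  have [P [MP P0 Pu]] := dcl_algebraic char0 ringM uM.
  by exists (size P); apply/asboolP; exists P.
case: (ex_minnP exb) => m /asboolP [P [MP P0 Pu sP]] mmin.
have lP : lead_coef P != 0 by rewrite lead_coef_eq0.
exists ((lead_coef P)^-1 *: P); split.
- by apply: poly_overZ => //; apply: fieldM.2; exact: MP.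
- by rewrite monicE lead_coefZ mulVf.
- by rewrite hornerZ Pu mulr0.
- move=> Q MQ Qu; rewrite size_scale ?invr_eq0 // sP ltnNge => /negP sQ.
  apply: contrapT => /eqP Q0; apply: sQ; apply: mmin; apply/asboolP.
  by exists Q.
Qed.

Lemma minpoly_dvd u P Q : minpoly M u P -> poly_over M Q -> Q.[u] = 0 ->
  exists A, Q = A * P.
Proof.
move=> [MP monP Pu minP] MQ Qu.
have [A [B [MA MB eQ sB]]] := poly_over_edivp ringM MP monP MQ.
exists A; rewrite eQ (minP B) ?addr0 //.
by move: Qu; rewrite eQ !hornerE Pu mulr0 add0r.
Qed.

Lemma minpoly_size u P : minpoly M u P -> (1 < size P)%N.
Proof.
move=> [MP monP Pu minP]; rewrite ltnNge; apply/negP => /size1_polyC Pc.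
move: Pu (monic_neq0 monP); rewrite Pc hornerC polyC_eq0 => ->.
by rewrite eqxx.
Qed.

Lemma minpoly_deriv_neq0 u P : minpoly M u P -> P^`().[u] != 0.
Proof.
move=> mP; have [MP monP Pu minP] := mP; have sP := minpoly_size mP.
apply/eqP => P'u; have /(congr1 (fun Q : {poly U} => Q`_(size P).-2)) : P^`() = 0.
  apply: minP => //; first exact: poly_over_deriv.
  by apply: lt_size_deriv; exact: monic_neq0.
rewrite coef0 coef_deriv.
have -> : (size P).-2.+1 = (size P).-1 by rewrite prednK // -ltnS prednK // ltnW.
rewrite -/(lead_coef P) (monicP monP); move: sP; case: (size P) => [|[|k]] // _ /eqP.
by rewrite (negPf (natr_neq0 char0 _)).
Qed.

(** The normalized trace of [r]. Differentiating the minimal polynomial of [r],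
in which the leading coefficient is constant, yields a polynomial of smaller
size vanishing at [r], hence 0, one coefficient of which expresses [D r] as a
derivative of an element of [M]. *)
Lemma primitive_descent (D : U -> U) (r : U) : is_derivation D -> (forall c, M c -> M (D c)) ->
  dcl M r -> M (D r) -> exists2 r0, M r0 & D r0 = D r.
Proof.
move=> derD DM rM MDr; have [P mP] := minpoly_ex rM.
have [MP monP Pr minP] := mP; have := minpoly_size mP.
case sP: (size P) => [|[|N]] // _.
have PN : P`_N.+1 = 1 by have := monicP monP; rewrite /lead_coef sP.
have W0 : map_poly D P + D r *: P^`() = 0.
  apply: minP.
  - apply: (poly_overD ringM); first exact: poly_over_map.
    by apply: poly_overZ => //; exact: poly_over_deriv.
  - by rewrite !hornerE [D r * _]mulrC -(der_horner derD) Pr (der0 derD).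
  - rewrite sP ltnS; apply/leq_sizeP => j hj; rewrite coefD coefZ coef_map_der // coef_deriv.
    have -> : P`_j.+1 = 0 by apply: nth_default; rewrite sP.
    rewrite mul0rn mulr0 addr0; move: hj; rewrite leq_eqVlt => /orP[/eqP <-|hj].
      by rewrite PN (der1 derD).
    by rewrite (nth_default 0) ?sP // (der0 derD).
have := congr1 (fun Q : {poly U} => Q`_N) W0.
rewrite coef0 coefD coefZ coef_map_der // coef_deriv PN => eN.
have N0 := natr_neq0 char0 N.
exists (- P`_N / N.+1%:R).
  apply: (subringM ringM); first by apply: subringN => //; exact: MP.
  by apply: fieldM.2; exact: subring_nat.
rewrite (der_div derD) // (der_nat derD) mulr0 subr0 (derN derD).
move/eqP: eN; rewrite addr_eq0 => /eqP ->.
by rewrite opprK; field; rewrite nat1r.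
Qed.

Lemma ring_ext_subring p : subring (ring_ext M p).
Proof.
split.
- by exists 1; rewrite ?hornerC //; apply: poly_overC (subring1 ringM).
- move=> _ _ [R MR ->] [S MS ->]; exists (R - S); rewrite ?hornerE //.
  exact: poly_overB.
- move=> _ _ [R MR ->] [S MS ->]; exists (R * S); rewrite ?hornerE //.
  exact: poly_overM.
Qed.

Lemma ring_ext_base p c : M c -> ring_ext M p c.
Proof. by move=> Mc; exists c%:P; rewrite ?hornerC //; exact: poly_overC. Qed.

Lemma ring_ext_gen p : ring_ext M p p.
Proof. by exists 'X; rewrite ?hornerX //; exact: poly_overX. Qed.

Lemma poly_over_behead Q : poly_over M Q -> Q != 0 ->
  exists A, [/\ poly_over M A, Q = A * 'X + (Q`_0)%:P & (size A < size Q)%N].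
Proof.
move=> MQ Q0; exists (\poly_(i < (size Q).-1) Q`_i.+1).
have sQ : (0 < size Q)%N by rewrite size_poly_gt0.
split.
- by move=> i; rewrite coef_poly; case: ifP => _; [exact: MQ|exact: subring0].
- apply/polyP=> i; rewrite coefD coefMX coefC coef_poly.
  case: i => [|i] /=; first by rewrite add0r.
  rewrite addr0; case: ltnP => // h; apply: nth_default.
  by rewrite -ltnS prednK // in h.
- by apply: leq_ltn_trans (size_poly _ _) _; rewrite prednK.
Qed.

(** Otherwise [P] divided by ['X] would still vanish at [u]. *)
Lemma minpoly_coef0 u P : minpoly M u P -> u != 0 -> P`_0 != 0.
Proof.
move=> [MP monP Pu minP] u0; apply/eqP => P00.
have [A [MA eP sA]] := poly_over_behead MP (monic_neq0 monP).
have Au : A.[u] = 0.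
  move: Pu; rewrite eP P00 !hornerE => /eqP.
  by rewrite mulf_eq0 (negPf u0) orbF => /eqP.
have A0 := minP A MA Au sA; have := monic_neq0 monP.
by rewrite eP A0 P00 mul0r addr0 eqxx.
Qed.

Lemma dcl_root P z : poly_over M P -> P.[z] = 0 -> P^`().[z] != 0 -> dcl M z.
Proof.
move=> MP Pz P'z D derD DM; apply/eqP.
rewrite -(mulIr_eq0 _ (mulIf P'z)) (der_root derD Pz).
have -> : map_poly D P = 0 by apply/polyP=> i; rewrite coef_map_der // coef0 DM.
by rewrite horner0 oppr0.
Qed.

(** The minimal polynomial of an element [v] of [M[p]] expresses [v^-1] as a
polynomial in [v]. *)
Lemma ring_ext_subfield p : dcl M p -> subfield (ring_ext M p).
Proof.
move=> pM; have ringMp := ring_ext_subring p; split=> // v [R MR ev].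
have [->|v0] := eqVneq v 0; first by rewrite invr0; exact: subring0.
have vM : dcl M v.
  rewrite ev; have [ringcl _] := dcl_subfield M.
  by apply: (subring_horner ringcl) => // i; apply: sub_dcl; exact: MR.
have [Q mQ] := minpoly_ex vM; have MQ := minpoly_over mQ.
have [A [MA eQ _]] := poly_over_behead MQ (monic_neq0 (minpoly_monic mQ)).
have Q00 := minpoly_coef0 mQ v0.
have eAv : A.[v] * v = - Q`_0.
  by have := minpoly_root mQ; rewrite {1}eQ !hornerE => /eqP; rewrite addr_eq0 => /eqP.
have -> : v^-1 = A.[v] * - (Q`_0)^-1.
  apply: (mulIf v0); rewrite mulVf // mulrAC eAv.
  by field.
apply: (subringM ringMp).
  apply: (subring_horner ringMp); last by exists R.
  by move=> i; apply: ring_ext_base; exact: MA.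
by apply: ring_ext_base; apply: subringN => //; apply: fieldM.2; exact: MQ.
Qed.

Lemma ring_ext_stable (D : U -> U) (p : U) : is_derivation D -> (forall c, M c -> M (D c)) ->
  dcl M p -> forall m, ring_ext M p m -> ring_ext M p (D m).
Proof.
move=> derD DM pM _ [R MR ->].
have [ringMp invMp] := ring_ext_subfield pM.
have [P mP] := minpoly_ex pM; have [MP monP Pp minP] := mP.
have Dp : ring_ext M p (D p).
  have -> : D p = - (map_poly D P).[p] / P^`().[p].
    by rewrite -(der_root derD Pp) mulfK // (minpoly_deriv_neq0 mP).
  apply: (subringM ringMp); first apply: (subringN ringMp).
    by exists (map_poly D P) => //; exact: poly_over_map.
  by apply: invMp; exists P^`() => //; exact: poly_over_deriv.
rewrite (der_horner derD); apply: (subringD ringMp).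
  by exists (map_poly D R) => //; exact: poly_over_map.
by apply: (subringM ringMp) => //; exists R^`() => //; exact: poly_over_deriv.
Qed.

End MinPoly.

Lemma der_prod_log (E : U -> U) (s : seq U) : is_derivation E -> all (predC1 0) s ->
  E (\prod_(z <- s) z) / (\prod_(z <- s) z) = \sum_(z <- s) E z / z.
Proof.
move=> derE; elim: s => [|z s IH] /=; first by rewrite !big_nil (der1 derE) mul0r.
move=> /andP[z0 s0]; rewrite !big_cons -IH // (derM derE).
have p0 : \prod_(j <- s) j != 0.
  by apply: contraTneq s0; move=> /eqP; rewrite prodf_seq_eq0 => /hasP [t ts /= t0];
     apply/allPn; exists t => //=; rewrite negbK.
by field; rewrite p0.
Qed.

(** First [r] is brought into [M[p]] by [primitive_descent], say [r = R(p)]. The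
relation is then polynomial in [p], so it holds for all the conjugates of [p].
Summing it over them replaces [p] by its norm, and a second use of
[primitive_descent] brings the sum of the [R(z)] into [M]. *)
Lemma log_trace (M : set U) (d E : U -> U) (p r f : U) : subfield M ->
  (forall P : {poly U}, exists s, P = lead_coef P *: \prod_(z <- s) ('X - z%:P)) ->
  is_derivation d -> is_derivation E ->
  (forall c, M c -> M (d c)) -> (forall c, M c -> M (E c)) ->
  dcl M p -> dcl M r -> p != 0 -> M f -> f = E p / p + d r ->
  exists N n t, [/\ M n, n != 0, M t & N.+1%:R * f = E n / n + d t].
Proof.
move=> fieldM splitU derd derE dM EM pM rM p0 Mf ef; have ringM := fieldM.1.
have [P mP] := minpoly_ex fieldM pM; have [MP monP Pp minP] := mP.
have fieldMp := ring_ext_subfield fieldM pM; have [ringMp invMp] := fieldMp.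
have dMp := ring_ext_stable fieldM derd dM pM.
have EMp := ring_ext_stable fieldM derE EM pM.
have Mp : ring_ext M p p by exact: ring_ext_gen.
have [_ [R MR ->] dR] : exists2 r0, ring_ext M p r0 & d r0 = d r.
  apply: primitive_descent => //.
    by apply: dclS rM => c; exact: ring_ext_base.
  have -> : d r = f - E p / p by rewrite ef addrC addKr.
  apply: (subringB ringMp); first exact: ring_ext_base.
  by apply: (subringM ringMp); [exact: EMp|exact: invMp].
(* [H(z)] is [P'(z) * (z * f - E z - z * d (R(z)))] at every root [z] of [P]:
   the values of [E] and [d] at a root are eliminated by [der_root]. *)
pose H := f *: ('X * P^`()) + map_poly E P
  - 'X * (map_poly d R * P^`() - R^`() * map_poly d P).
have MH : poly_over M H.
  apply: (poly_overB ringM).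
    apply: (poly_overD ringM); last exact: poly_over_map.
    apply: (poly_overZ ringM) => //; apply: (poly_overM ringM); first exact: poly_overX.
    exact: poly_over_deriv.
  apply: (poly_overM ringM); first exact: poly_overX.
  apply: (poly_overB ringM); apply: (poly_overM ringM).
  - exact: poly_over_map.
  - exact: poly_over_deriv.
  - exact: poly_over_deriv.
  - exact: poly_over_map.
have valH z : P.[z] = 0 -> H.[z] = P^`().[z] * (z * f - E z - z * d R.[z]).
  move=> Pz; have eE := der_root derE Pz; have ed := der_root derd Pz.
  rewrite /H !(hornerD, hornerN, hornerZ, hornerM, hornerX).
  have -> : (map_poly E P).[z] = - (E z * P^`().[z]) by rewrite eE opprK.
  have -> : (map_poly d P).[z] = - (d z * P^`().[z]) by rewrite ed opprK.
  by rewrite (der_horner derd); ring.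
have P'p := minpoly_deriv_neq0 fieldM mP.
have Hp : H.[p] = 0.
  by rewrite valH // dR ef; field.
have [A eA] := minpoly_dvd fieldM mP MH Hp.
(* [P'] is invertible modulo [P], so that every conjugate is a simple root. *)
have [T MT eT] : ring_ext M p (P^`().[p])^-1.
  by apply: invMp; exists P^`() => //; exact: poly_over_deriv.
have [A' eA'] : exists A', T * P^`() - 1 = A' * P.
  apply: (minpoly_dvd fieldM mP).
    apply: (poly_overB ringM); last exact: poly_overC (subring1 ringM).
    by apply: (poly_overM ringM) => //; exact: poly_over_deriv.
  by rewrite !hornerE -eT mulVf // subrr.
have P'z z : P.[z] = 0 -> P^`().[z] != 0.
  move=> Pz; apply/eqP => P'z0; have := congr1 (fun Q => Q.[z]) eA'.
  by rewrite /= !hornerE P'z0 Pz !mulr0 sub0r => /eqP; rewrite oppr_eq0 oner_eq0.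
have P0 : P.[0] != 0.
  by rewrite horner_coef0; exact: (minpoly_coef0 fieldM mP p0).
have [s es] := splitU P; rewrite (monicP monP) scale1r in es.
have rs z : z \in s -> P.[z] = 0 /\ z != 0.
  move=> zs; have Pz : P.[z] = 0 by apply/rootP; rewrite es root_prod_XsubC.
  by split=> //; apply: contraNneq P0 => z0; rewrite z0 in Pz; rewrite Pz.
have fz z : z \in s -> f = E z / z + d R.[z].
  move=> /rs [Pz z0]; have := valH z Pz; rewrite eA hornerM Pz mulr0 => /esym/eqP.
  rewrite mulf_eq0 (negPf (P'z z Pz)) /= subr_eq0 subr_eq => /eqP h.
  by apply: (mulfI z0); rewrite h; field.
have s_gt0 : (0 < size s)%N.
  by rewrite -ltnS -(size_prod_XsubC s id) -es (minpoly_size mP).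
have eP0 : P.[0] = \prod_(z <- [seq - z | z <- s]) z.
  rewrite {1}es horner_prod big_map; apply: eq_bigr => z _.
  by rewrite hornerXsubC sub0r.
have logP0 : E P.[0] / P.[0] = \sum_(z <- s) E z / z.
  rewrite eP0 der_prod_log //.
    by rewrite big_map; apply: eq_bigr => z _; rewrite (derN derE) invrN mulrNN.
  by apply/allP => _ /mapP [z /rs [_ z0] ->] /=; rewrite oppr_eq0.
pose t := \sum_(z <- s) R.[z].
have dt : d t = (size s)%:R * f - E P.[0] / P.[0].
  apply/eqP; rewrite eq_sym subr_eq addrC logP0 (der_sum derd) -big_split /=.
  rewrite mulr_natl -[X in _ *+ X]count_predT -iter_addr_0 -big_const_seq; apply/eqP.
  by rewrite big_seq [RHS]big_seq; apply: eq_bigr => z /fz.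
have MP0 : M P.[0] by rewrite horner_coef0; exact: MP.
have tM : dcl M t.
  have [ringcl _] := dcl_subfield M.
  rewrite /t big_seq; apply: (subring_sum ringcl) => z /rs [Pz _].
  apply: (subring_horner ringcl); first by move=> i; apply: sub_dcl; exact: MR.
  exact: dcl_root MP Pz (P'z z Pz).
have [t0 Mt0 dt0] : exists2 t0, M t0 & d t0 = d t.
  apply: primitive_descent => //; rewrite dt; apply: (subringB ringM).
    by apply: (subringM ringM) => //; exact: subring_nat.
  by apply: (subringM ringM); [exact: EM|exact: fieldM.2].
exists (size s).-1, P.[0], t0; split=> //.
by rewrite prednK // dt0 dt addrC subrK.
Qed.

End Extensions.

(** * Residues *)

Section Local.
Variable U : fieldType.
Hypothesis char0 : [pchar U] =i pred0.
Variables (K : set U) (fieldK : subfield K) (d : U -> U) (derd : is_derivation d).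
Variables (dK : kills d K) (x : U) (dx : d x = 1).
Let ringK := fieldK.1.

Lemma der_polyK P : poly_over K P -> d P.[x] = P^`().[x].
Proof.
move=> KP; rewrite (der_horner derd) dx mulr1 (_ : map_poly d P = 0) ?horner0 ?add0r //.
by apply/polyP=> i; rewrite coef_map_der // coef0 dK.
Qed.

Lemma poly_over_transcendental P : poly_over K P -> P.[x] = 0 -> P = 0.
Proof.
have [n] := ubnP (size P); elim: n P => // n IH P sP KP Px.
have [->//|P0] := eqVneq P 0.
have P'0 : P^`() = 0.
  apply: IH; first by rewrite -ltnS (leq_trans _ sP) // ltnS lt_size_deriv.
    exact: poly_over_deriv.
  by rewrite -der_polyK // Px (der0 derd).
have sP1 : (size P <= 1)%N.
  rewrite leqNgt; apply/negP => sP1.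
  have := congr1 (fun Q : {poly U} => Q`_(size P).-2) P'0.
  rewrite coef0 coef_deriv.
  have -> : (size P).-2.+1 = (size P).-1 by rewrite prednK // -ltnS prednK // ltnW.
  move/eqP; rewrite -mulr_natr mulf_eq0 -/(lead_coef P) lead_coef_eq0 (negPf P0) /=.
  by move: sP1; case: (size P) => [|[|k]] // _; rewrite (negPf (natr_neq0 char0 _)).
by move: Px; rewrite (size1_polyC sP1) hornerC => ->.
Qed.

Lemma horner_neq0 P a : poly_over K P -> P.[a] != 0 -> P.[x] != 0.
Proof.
move=> KP; apply: contraNneq => /(poly_over_transcendental KP) ->.
by rewrite horner0.
Qed.

Variables (a : U) (Ka : K a).

(** The local ring of [K(x)] at [x = a]. *)
Definition regular : set U :=
  [set m | exists u v, [/\ poly_over K u, poly_over K v, v.[a] != 0 &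
                           m = u.[x] / v.[x]]].

Lemma regular_horner u : poly_over K u -> regular u.[x].
Proof.
move=> Ku; exists u, 1; rewrite !hornerC divr1 oner_eq0; split=> //.
exact: poly_overC (subring1 ringK).
Qed.

Lemma regular_base c : K c -> regular c.
Proof. by move=> Kc; rewrite -(hornerC c x); apply: regular_horner; exact: poly_overC. Qed.

Lemma regular_subring : subring regular.
Proof.
split.
- exact: regular_base (subring1 ringK).
- move=> _ _ [u [v [Ku Kv v0 ->]]] [u' [v' [Ku' Kv' v'0 ->]]].
  exists (u * v' - u' * v), (v * v'); rewrite !(hornerM, hornerD, hornerN) mulf_neq0 //.
  split=> //.
  + by apply: (poly_overB ringK); exact: poly_overM.
  + exact: poly_overM.
  + by field; rewrite !(@horner_neq0 _ a).
- move=> _ _ [u [v [Ku Kv v0 ->]]] [u' [v' [Ku' Kv' v'0 ->]]].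
  exists (u * u'), (v * v'); rewrite !hornerM mulf_neq0 //; split=> //.
  + exact: poly_overM.
  + exact: poly_overM.
  + by field; rewrite !(@horner_neq0 _ a).
Qed.

Lemma regular_stable D : is_derivation D -> (forall c, K c -> K (D c)) ->
  K (D x) -> forall m, regular m -> regular (D m).
Proof.
move=> derD DK KDx _ [u [v [Ku Kv v0 ->]]].
have KD c : poly_over K c -> exists2 c1, poly_over K c1 & D c.[x] = c1.[x].
  move=> Kc; exists (map_poly D c + (D x) *: c^`()).
    apply: (poly_overD ringK); first exact: poly_over_map.
    by apply: poly_overZ => //; exact: poly_over_deriv.
  by rewrite (der_horner derD) hornerD hornerZ [D x * _]mulrC.
have [u1 Ku1 eu1] := KD u Ku; have [v1 Kv1 ev1] := KD v Kv.
exists (u1 * v - u * v1), (v ^+ 2); split.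
- by apply: (poly_overB ringK); exact: poly_overM.
- by rewrite expr2; exact: poly_overM.
- by rewrite horner_exp expf_neq0.
- by rewrite (der_div derD) ?(@horner_neq0 _ a) // eu1 ev1 !(hornerM, hornerD, hornerN).
Qed.

(** An identity [v(x) = (x - a) u(x)] is an identity of polynomials since [x] is
transcendental, and it forces [v(a) = 0]. *)
Lemma XsubC_nonunit g : regular g -> (x - a) * g != 1.
Proof.
move=> [u [v [Ku Kv v0 ->]]]; have vx := horner_neq0 Kv v0.
apply: contraNneq v0 => e.
have : v - ('X - a%:P) * u = 0.
  apply: poly_over_transcendental.
    apply: (poly_overB ringK) => //; apply: (poly_overM ringK) => //.
    by apply: (poly_overB ringK); [exact: poly_overX|exact: poly_overC].
  rewrite !(hornerM, hornerD, hornerN) hornerX hornerC -[v.[x]]mul1r -e.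
  by field.
move/(congr1 (fun P => P.[a])).
by rewrite !(hornerM, hornerD, hornerN) hornerX hornerC horner0 subrr mul0r subr0 => ->.
Qed.

Lemma Xsub_neq0 : x - a != 0.
Proof.
apply/eqP => e; have /eqP := dx; rewrite -(subrK a x) e add0r dK // eq_sym.
by rewrite oner_eq0.
Qed.

Lemma poly_over_multiplicity P : poly_over K P -> P != 0 ->
  exists j Q, [/\ poly_over K Q, Q.[a] != 0 & P = Q * ('X - a%:P) ^+ j].
Proof.
have [n] := ubnP (size P); elim: n P => // n IH P sP KP P0.
have [Pa|Pa] := eqVneq P.[a] 0; last by exists 0%N, P; rewrite mulr1.
have KXa : poly_over K ('X - a%:P).
  by apply: (poly_overB ringK); [exact: poly_overX|exact: poly_overC].
have [A [B [KA KB eP sB]]] := poly_over_edivp ringK KXa (monicXsubC a) KP.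
have B0 : B = 0.
  rewrite size_XsubC ltnS in sB; have eB := size1_polyC sB.
  by move: Pa; rewrite eP eB hornerD hornerM hornerXsubC subrr mulr0 add0r hornerC => ->.
rewrite B0 addr0 in eP.
have A0 : A != 0 by apply: contraNneq P0; rewrite eP => ->; rewrite mul0r.
have [||//|j [Q [KQ Qa eA]]] := IH A.
- rewrite ltnS in sP; apply: leq_trans sP.
  by rewrite eP size_Mmonic ?monicXsubC // size_XsubC addn2.
- by [].
by exists j.+1, Q; split=> //; rewrite eP eA exprSr mulrA.
Qed.

(** Every element is a unit times a power of the uniformizer [x - a]. *)
Lemma frac_ext_local m : frac_ext K x m -> m != 0 ->
  exists o (j : nat), [/\ regular o, regular o^-1, o != 0 &
    m = o * (x - a) ^+ j \/ m = o / (x - a) ^+ j].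
Proof.
move=> [P [Q [KP KQ Qx ->]]] m0; have Xa := Xsub_neq0.
have P0 : P != 0 by apply: contraNneq m0 => ->; rewrite horner0 mul0r.
have Q0 : Q != 0 by apply: contraNneq Qx => ->; rewrite horner0.
have [i [u [Ku ua eu]]] := poly_over_multiplicity KP P0.
have [j [v [Kv va ev]]] := poly_over_multiplicity KQ Q0.
have ux := horner_neq0 Ku ua; have vx := horner_neq0 Kv va.
rewrite eu ev !(hornerM, horner_exp) hornerXsubC.
exists (u.[x] / v.[x]).
have [ji|ij] := leqP j i.
  exists (i - j)%N; split.
  - by exists u, v.
  - by exists v, u; rewrite invf_div.
  - by rewrite mulf_neq0 ?invr_eq0.
  - left; rewrite -[in LHS](subnK ji) exprD; field.
    by rewrite vx expf_neq0.
exists (j - i)%N; split.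
- by exists u, v.
- by exists v, u; rewrite invf_div.
- by rewrite mulf_neq0 ?invr_eq0.
- right; rewrite -[in LHS](subnK (ltnW ij)) exprD; field.
  by rewrite vx !expf_neq0.
Qed.

Lemma regularXa : regular (x - a).
Proof.
rewrite -[x - a](hornerXsubC a x); apply: regular_horner.
by apply: (poly_overB ringK); [exact: poly_overX|exact: poly_overC].
Qed.

(** If [t] is regular so is [d t]; if [t] has a pole of order [j] then [d t] has
one of order [j + 1], which is at least 2. *)
Lemma exact_no_residue t rho h : frac_ext K x t -> regular h -> K rho ->
  d t = rho / (x - a) + h -> rho = 0.
Proof.
move=> Kt rh Krho edt; have Xa := Xsub_neq0; have ringO := regular_subring.
have dO m : regular m -> regular (d m).
  apply: regular_stable => //; first by move=> c /dK ->; exact: subring0.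
  by rewrite dx; exact: subring1.
apply: contrapT => /eqP rho0.
have noreg : ~ regular (d t).
  move=> rdt; have /negP := XsubC_nonunit (subringM ringO
    (regular_base (fieldK.2 _ Krho)) (subringB ringO rdt rh)).
  by apply; apply/eqP; rewrite edt; field; rewrite rho0 Xa.
have rX n : regular ((x - a) ^+ n) by apply: subringX => //; exact: regularXa.
have t0 : t != 0.
  by apply/eqP => t0; apply: noreg; rewrite t0 (der0 derd); exact: subring0.
have [o [j [ro rVo o0 et]]] := frac_ext_local Kt t0.
case: et => et; first by apply: noreg; apply: dO; rewrite et; exact: subringM.
case: j et => [|j] et; first by apply: noreg; apply: dO; rewrite et expr0 divr1.
have dXa : d (x - a) = 1 by rewrite (derB derd) dx dK // subr0.
have j0 := natr_neq0 char0 j.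
have rj : regular (j.+1%:R^-1).
  by apply: regular_base; apply: fieldK.2; exact: subring_nat.
(* Multiplying the relation by [(x - a) ^+ j.+2] and dividing by the unit [o]
   exhibits 1 as a multiple of [x - a]. *)
pose g := j.+1%:R^-1 * (o^-1 * (d o - rho * (x - a) ^+ j - h * (x - a) ^+ j.+1)).
have rg : regular g.
  do 2! apply: (subringM ringO) => //.
  apply: (subringB ringO); last by apply: (subringM ringO).
  by apply: (subringB ringO); [exact: dO|apply: (subringM ringO) => //; exact: regular_base].
have /negP := XsubC_nonunit rg; apply; apply/eqP.
have e : h = d t - rho / (x - a) by rewrite edt addrC addKr.
rewrite /g e et (der_div derd) ?expf_neq0 // (derXn derd) dXa mulr1 /= !exprS.
move: j0; rewrite -nat1r => j0; field.
by rewrite j0 o0 Xa expf_neq0.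
Qed.

(** The factor [(x - a) ^+ j] of [n] is a constant of [E]. *)
Lemma log_regular E n : is_derivation E -> (forall c, K c -> K (E c)) ->
  E x = 0 -> E a = 0 -> frac_ext K x n -> n != 0 -> regular (E n / n).
Proof.
move=> derE EK Ex Ea Kn n0; have Xa := Xsub_neq0; have ringO := regular_subring.
have [o [j [ro rVo o0 en]]] := frac_ext_local Kn n0.
have EXa : E ((x - a) ^+ j) = 0 by rewrite (derXn derE) (derB derE) Ex Ea subrr mulr0.
have -> : E n / n = E o / o.
  case: en => ->; first by rewrite (derM derE) EXa; field; rewrite o0 expf_neq0.
  by rewrite (der_div derE) ?expf_neq0 // EXa; field; rewrite o0 expf_neq0.
apply: (subringM ringO) => //; apply: regular_stable => //.
by rewrite Ex; exact: subring0.
Qed.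

End Local.

(** * Partial fractions *)

Section PartialFractions.
Variables (U : fieldType) (k : closedFieldType) (iota : {rmorphism k -> U}).
Hypothesis char0 : [pchar U] =i pred0.
Variables (d : U -> U) (derd : is_derivation d) (d_iota : kills d (range iota)).
Variables (x : U) (dx : d x = 1).

Lemma range_subfield : subfield (range iota).
Proof.
split; [split|].
- by exists 1; rewrite ?rmorph1.
- by move=> _ _ [a _ <-] [b _ <-]; exists (a - b); rewrite ?rmorphB.
- by move=> _ _ [a _ <-] [b _ <-]; exists (a * b); rewrite ?rmorphM.
- by move=> _ [a _ <-]; exists a^-1; rewrite ?fmorphV.
Qed.

Lemma range_iota c : range iota (iota c). Proof. by exists c. Qed.

Lemma poly_over_rangeP (p : {poly U}) :
  poly_over (range iota) p <-> exists q, p = map_poly iota q.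
Proof.
split=> [h|[q ->] i]; last by rewrite coef_map; exact: range_iota.
have {}h i : exists c, iota c = p`_i by have [c _ <-] := h i; exists c.
have [c ec] := choice h; exists (\poly_(i < size p) c i).
apply/polyP=> i; rewrite coef_map coef_poly; case: ltnP => [_|pi]; first by rewrite /= ec.
by rewrite nth_default //; exact/esym/(rmorph0 iota).
Qed.

Let Cx := frac_ext (range iota) x.
Let ringC := range_subfield.1.
Let fieldCx := frac_ext_subfield x ringC.
Let ringCx := fieldCx.1.

Lemma d_iota0 c : d (iota c) = 0.
Proof. by apply: d_iota; exact: range_iota. Qed.

Lemma sub_iota_neq0 b : x - iota b != 0.
Proof.
apply/eqP => e; have /eqP := dx.
by rewrite -(subrK (iota b) x) e add0r d_iota0 eq_sym oner_eq0.
Qed.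

(** The poles are listed in a fixed [s], some of them possibly with residue 0,
so that such decompositions can be added termwise. *)
Definition polar (s : seq k) (rho : k -> k) (z : U) : U :=
  \sum_(b <- s) iota (rho b) / (z - iota b).

Definition decomposes (s : seq k) (m : U) : Prop :=
  exists G rho, Cx G /\ m = d G + polar s rho x.

Lemma decomposesD s m1 m2 :
  decomposes s m1 -> decomposes s m2 -> decomposes s (m1 + m2).
Proof.
move=> [G1 [r1 [C1 ->]]] [G2 [r2 [C2 ->]]].
exists (G1 + G2), (fun b => r1 b + r2 b); split; first exact: subringD.
rewrite (derD_ derd) addrACA /polar -big_split /=; congr (_ + _).
by apply: eq_bigr => b _; rewrite rmorphD mulrDl.
Qed.

Lemma decomposesZ s c m : decomposes s m -> decomposes s (iota c * m).
Proof.
move=> [G [r [CG ->]]]; exists (iota c * G), (fun b => c * r b); split.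
  by apply: (subringM ringCx) => //; apply: frac_ext_base; [exact: ringC|exact: range_iota].
rewrite (derM derd) d_iota0 mul0r add0r mulrDr /polar mulr_sumr; congr (_ + _).
by apply: eq_bigr => b _; rewrite rmorphM mulrA.
Qed.

Lemma decomposes_exact s G : Cx G -> decomposes s (d G).
Proof.
move=> CG; exists G, (fun=> 0); split=> //.
by rewrite /polar big1 ?addr0 // => b _; rewrite rmorph0 mul0r.
Qed.

Lemma decomposes_sum s (I : Type) (r : seq I) (F : I -> U) :
  (forall i, decomposes s (F i)) -> decomposes s (\sum_(i <- r) F i).
Proof.
move=> h; elim: r => [|i r IH]; last by rewrite big_cons; exact: decomposesD.
by rewrite big_nil -(der0 derd); apply: decomposes_exact; exact: (subring0 ringCx).
Qed.

Let Cxx : Cx x. Proof. exact: (frac_ext_gen x ringC). Qed.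

Lemma frac_ext_iota c : Cx (iota c).
Proof. by apply: frac_ext_base; [exact: ringC|exact: range_iota]. Qed.

Lemma Cx_XsubC b : Cx (x - iota b).
Proof. by apply: (subringB ringCx) => //; exact: frac_ext_iota. Qed.

Lemma decomposes_poly s (p : {poly k}) : decomposes s (map_poly iota p).[x].
Proof.
rewrite horner_coef; apply: decomposes_sum => i; rewrite coef_map; apply: decomposesZ.
have i0 := natr_neq0 char0 i.
have -> : x ^+ i = d (x ^+ i.+1 / i.+1%:R).
  by rewrite (der_div derd) // (der_nat derd) (derXn derd) dx mulr0 subr0 mulr1 /=;
     move: i0; rewrite -nat1r => i0; field.
apply: decomposes_exact; apply: (subringM ringCx); first exact: subringX.
by apply: fieldCx.2; exact: subring_nat.
Qed.

Lemma decomposes_power s b n : uniq s -> b \in s ->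
  decomposes s ((x - iota b) ^+ n)^-1.
Proof.
move=> us bs; have xb := sub_iota_neq0 b.
case: n => [|[|n]].
- have -> : ((x - iota b) ^+ 0)^-1 = (map_poly iota 1).[x].
    by rewrite expr0 invr1 rmorph1 hornerC.
  exact: decomposes_poly.
- exists 0, (fun c => if c == b then 1 else 0); split; first exact: (subring0 ringCx).
  rewrite (der0 derd) add0r /polar (bigD1_seq b) //= eqxx rmorph1 big1 ?addr0 ?div1r //.
  by move=> c /negPf ->; rewrite rmorph0 mul0r.
have n0 := natr_neq0 char0 n.
have -> : ((x - iota b) ^+ n.+2)^-1 = d (- (n.+1%:R^-1 / (x - iota b) ^+ n.+1)).
  rewrite (derN derd) (der_div derd) ?expf_neq0 // (derXn derd) (derB derd) dx d_iota0.
  rewrite (derV derd) (der_nat derd) /= !exprS subr0.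
  by move: n0; rewrite -nat1r => n0; field; rewrite xb n0 expf_neq0.
apply: decomposes_exact; apply: (subringN ringCx).
apply: (subringM ringCx); apply: fieldCx.2; first exact: subring_nat.
by apply: subringX => //; exact: Cx_XsubC.
Qed.

(** Euclidean division by [X - b] reduces to numerators that are constant. If the
denominator has two distinct roots [b] and [c], then
1/((x-b)(x-c)) = (1/(x-b) - 1/(x-c))/(b-c) makes it shorter; otherwise it is a
power of [x - b]. *)
Lemma partial_fractions s l p : uniq s -> {subset l <= s} ->
  decomposes s ((map_poly iota p).[x] / \prod_(c <- l) (x - iota c)).
Proof.
move=> us; have [n] := ubnP (size l); elim: n l p => // n IH [|b l] p sl ls.
  by rewrite big_nil divr1; exact: decomposes_poly.
have bs : b \in s by apply: ls; rewrite mem_head.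
have ll : {subset l <= s} by move=> c cl; apply: ls; rewrite inE cl orbT.
have xb := sub_iota_neq0 b.
have pr0 (l' : seq k) : \prod_(c <- l') (x - iota c) != 0.
  by elim: l' => [|c l' h]; rewrite ?big_nil ?oner_eq0 // big_cons mulf_neq0 // sub_iota_neq0.
have sl' : (size l < n)%N by [].
have unitfrac : decomposes s (\prod_(c <- b :: l) (x - iota c))^-1.
  have [/all_pred1P el|/allPn [c cl cb]] := boolP (all (pred1 b) l).
    have prn m : \prod_(c <- nseq m b) (x - iota c) = (x - iota b) ^+ m.
      by elim: m => [|m h]; rewrite ?big_nil ?expr0 //= big_cons h exprS.
    by rewrite el big_cons prn -exprS; exact: decomposes_power.
  have bc : iota b - iota c != 0.
    by rewrite subr_eq0 (inj_eq (fmorph_inj iota)) eq_sym.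
  have ec : perm_eq l (c :: rem c l) by exact: perm_to_rem.
  have szc : (size (b :: rem c l) < n)%N.
    by rewrite /= size_rem // prednK //; case: (l) cl.
  have -> : (\prod_(c <- b :: l) (x - iota c))^-1 = iota (b - c)^-1 *
      ((map_poly iota 1).[x] / \prod_(c <- b :: rem c l) (x - iota c)
       + iota (-1) * ((map_poly iota 1).[x] / \prod_(c <- l) (x - iota c))).
    rewrite rmorph1 hornerC !big_cons (perm_big _ ec) /= !big_cons.
    rewrite fmorphV rmorphB rmorphN rmorph1.
    move: (pr0 (rem c l)) (sub_iota_neq0 c); set P := \prod_(_ <- _) _ => P0 xc.
    by field; rewrite P0 bc xb xc.
  apply: decomposesZ; apply: decomposesD.
    apply: IH => // e; rewrite inE => /orP[/eqP -> //|/mem_rem]; exact: ll.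
  by apply: decomposesZ; apply: IH.
have [q eq] : exists q, p - (p.[b])%:P = q * ('X - b%:P).
  by apply/factor_theorem; rewrite /root !hornerE subrr.
have -> : (map_poly iota p).[x] / \prod_(c <- b :: l) (x - iota c) =
    (map_poly iota q).[x] / \prod_(c <- l) (x - iota c)
    + iota p.[b] * (\prod_(c <- b :: l) (x - iota c))^-1.
  rewrite -{1}(subrK (p.[b])%:P p) eq rmorphD rmorphM /= map_polyC map_polyXsubC.
  rewrite hornerD hornerM hornerXsubC hornerC !big_cons.
  by move: (pr0 l) => P0; field; rewrite P0 xb.
by apply: decomposesD; [exact: IH|exact: decomposesZ].
Qed.

End PartialFractions.

(** * Rational functions *)

Local Notation "x %:F" := (FracField.tofrac x) : ring_scope.

Lemma fraction_numden (R : idomainType) (f : {fraction R}) :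
  f = (\n_(repr f))%:F / (\d_(repr f))%:F.
Proof.
have d0 : (\d_(repr f))%:F != 0 by rewrite tofrac_eq0 denom_ratioP.
apply: (canRL (mulfK d0)).
rewrite -{1}[f]reprK; unlock FracField.tofrac; rewrite -[LHS]FracField.pi_mul.
apply/eqmodP; rewrite /= FracField.equivfE /FracField.mulf.
by rewrite !numden_Ratio ?mulr1 ?oner_neq0 ?denom_ratioP // mulrC.
Qed.

Section RationalFunctions.
Variable k : fieldType.
Implicit Types f g : {fraction {poly k}}.

Lemma rat_den_neq0 f : rat_den f != 0.
Proof.
rewrite /rat_den dvdp_div_eq0 ?dvdp_gcdr //; exact: denom_ratioP.
Qed.

Lemma eq_fraction (a b c d : {poly k}) : b != 0 -> d != 0 ->
  (a%:F / b%:F = c%:F / d%:F) <-> a * d = c * b.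
Proof.
move=> b0 d0; have h : (a%:F / b%:F == c%:F / d%:F) = (a * d == c * b).
  by rewrite eqr_div ?tofrac_eq0 // -!tofracM tofrac_eq.
by split=> /eqP; [rewrite h|rewrite -h] => /eqP.
Qed.

Lemma rat_numden f : f = (rat_num f)%:F / (rat_den f)%:F.
Proof.
rewrite {1}[f]fraction_numden; apply/eq_fraction; rewrite ?denom_ratioP ?rat_den_neq0 //.
by rewrite /rat_num /rat_den divp_mulA ?dvdp_gcdr // divp_mulAC ?dvdp_gcdl.
Qed.

(** The derivative may be computed from any representation as a quotient, not
only from the reduced one. *)
Lemma rat_deriv_div (a b : {poly k}) : b != 0 ->
  rat_deriv (a%:F / b%:F) = (a^`() * b - a * b^`())%:F / (b ^+ 2)%:F.
Proof.
move=> b0; have := rat_numden (a%:F / b%:F); have := rat_den_neq0 (a%:F / b%:F).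
rewrite /rat_deriv; set n := rat_num _; set d := rat_den _ => d0.
move/eq_fraction => /(_ b0 d0) e; apply/eq_fraction; rewrite ?expf_neq0 //.
have e' : a^`() * d + a * d^`() = n^`() * b + n * b^`() by rewrite -!derivM e.
apply/eqP; rewrite -subr_eq0; apply/eqP.
transitivity (d * b * ((n^`() * b + n * b^`()) - (a^`() * d + a * d^`()))
  - (d^`() * b + d * b^`()) * (n * b - a * d)); first by ring.
by rewrite e' e !subrr !mulr0 subrr.
Qed.

Variables (U : fieldType) (iota : {rmorphism k -> U}) (x : U).
Hypothesis x_transc : forall p : {poly k}, (map_poly iota p).[x] = 0 -> p = 0.

Lemma horner_transc_neq0 (p : {poly k}) : p != 0 -> (map_poly iota p).[x] != 0.
Proof. by apply: contra_neq => /x_transc. Qed.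

Lemma rat_eval_inj f (a b : {poly k}) : b != 0 ->
  rat_eval iota f x = (map_poly iota a).[x] / (map_poly iota b).[x] ->
  f = a%:F / b%:F.
Proof.
move=> b0 /eqP; rewrite eqr_div ?horner_transc_neq0 ?rat_den_neq0 // => /eqP e.
rewrite [f]rat_numden; apply/eq_fraction => //; first exact: rat_den_neq0.
apply/eqP; rewrite -subr_eq0; apply/eqP/x_transc.
by rewrite rmorphB !rmorphM !(hornerD, hornerN, hornerM) e subrr.
Qed.

End RationalFunctions.

(** * Functions with residues are not logarithmic derivatives plus exact ones *)

Section Core.
Variables (U : fieldType) (k : closedFieldType) (iota : {rmorphism k -> U}).
Hypothesis char0 : [pchar U] =i pred0.

Lemma iota_transc (d : U -> U) (x : U) : is_derivation d ->
  kills d (range iota) -> d x = 1 ->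
  forall p : {poly k}, (map_poly iota p).[x] = 0 -> p = 0.
Proof.
move=> derd dC dx p px; apply/eqP; rewrite -(map_poly_eq0 iota); apply/eqP.
apply: (poly_over_transcendental char0 (range_subfield iota) derd dC dx) => //.
by apply/poly_over_rangeP; exists p.
Qed.

(** If all residues vanished, [f] would be the derivative of [G]. *)
Lemma residue_exists (d : U -> U) (x : U) f : is_derivation d ->
  kills d (range iota) -> d x = 1 ->
  (forall g, f <> rat_deriv g) ->
  exists s rho G a, [/\ uniq s, frac_ext (range iota) x G,
    rat_eval iota f x = d G + polar iota s rho x, a \in s & rho a != 0].
Proof.
move=> derd dC dx fnd; have xtr := iota_transc derd dC dx.
have [r er] := closed_field_poly_normal (rat_den f).
have [G [rho [CG eG]]] : decomposes iota d x (undup r) (rat_eval iota f x).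
  have rs : {subset r <= undup r} by move=> c; rewrite mem_undup.
  have := partial_fractions char0 derd dC dx
    ((lead_coef (rat_den f))^-1 *: rat_num f) (undup_uniq r) rs.
  congr decomposes; rewrite /rat_eval.
  have -> : (map_poly iota (rat_den f)).[x] =
      iota (lead_coef (rat_den f)) * \prod_(c <- r) (x - iota c).
    rewrite [in LHS]er map_polyZ hornerZ rmorph_prod horner_prod; congr (_ * _).
    by apply: eq_bigr => c _; rewrite /= map_polyXsubC hornerXsubC.
  by rewrite map_polyZ hornerZ fmorphV invfM; ring.
have [/hasP [a ar ra]|/hasPn nores] := boolP (has (fun b => rho b != 0) (undup r)).
  by exists (undup r), rho, G, a; split=> //; exact: undup_uniq.
case: CG eG => _ [_ [/poly_over_rangeP [a ->] /poly_over_rangeP [b ->] bx ->]].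
rewrite /polar big_seq big1 ?addr0; last first.
  by move=> c /nores; rewrite negbK => /eqP ->; rewrite rmorph0 mul0r.
have Cp c : poly_over (range iota) (map_poly iota c) by apply/poly_over_rangeP; exists c.
have dp c : d (map_poly iota c).[x] = (map_poly iota c^`()).[x].
  by rewrite (der_polyK derd dC dx) // deriv_map.
rewrite (der_div derd) // !dp => e; case: (fnd (a%:F / b%:F)).
have b0 : b != 0 by apply: contraNneq bx => ->; rewrite rmorph0 horner0.
rewrite rat_deriv_div //; apply: (rat_eval_inj xtr); first by rewrite expf_neq0.
by rewrite e !expr2 rmorphB !rmorphM !(hornerD, hornerN, hornerM).
Qed.

(** The residue at [x = a] of a sum of simple fractions in an affine function of
[x]: only the pole [al * a + be], if it is one, contributes. *)
Lemma polar_local (K : set U) (d : U -> U) (x al be a : U) s rho :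
  subfield K -> range iota `<=` K -> is_derivation d -> kills d K -> d x = 1 ->
  K al -> K be -> K a -> al != 0 -> uniq s ->
  exists rho0 h, [/\ regular K x a h,
    polar iota s rho (al * x + be) = iota rho0 / (al * (x - a)) + h,
    rho0 = 0 \/ exists2 c, c \in s & al * a + be = iota c &
    forall c, c \in s -> al * a + be = iota c -> rho0 = rho c].
Proof.
move=> fieldK CK derd dK dx Kal Kbe Ka al0 us.
have ringK := fieldK.1; have ringO := regular_subring char0 fieldK derd dK dx a.
have Ki c : K (iota c) by apply: CK; exact: range_iota.
have reg b : al * a + be != iota b ->
    regular K x a (iota (rho b) / (al * x + be - iota b)).
  move=> ab; exists (iota (rho b))%:P, (al *: 'X + (be - iota b)%:P); split.
  - exact: poly_overC.
  - apply: (poly_overD ringK); first by apply: (poly_overZ ringK) => //; exact: poly_overX.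
    by apply: (poly_overC ringK); exact: subringB.
  - by rewrite hornerD hornerZ hornerX hornerC addrA subr_eq0.
  - by rewrite hornerD hornerZ hornerX !hornerC addrA.
have [[c cs ec]|none] := pselect (exists2 c, c \in s & al * a + be = iota c).
  exists (rho c), (\sum_(b <- s | b != c) iota (rho b) / (al * x + be - iota b)); split.
  - apply: (subring_sum ringO) => b bc; apply: reg.
    by rewrite ec (inj_eq (fmorph_inj iota)) eq_sym.
  - rewrite /polar (bigD1_seq c) //=; congr (_ / _ + _).
    by rewrite -ec; ring.
  - by right; exists c.
  - by move=> c' _; rewrite ec => /(fmorph_inj iota) ->.
exists 0, (polar iota s rho (al * x + be)); split.
- rewrite /polar big_seq; apply: (subring_sum ringO) => b bs; apply: reg.
  by apply/eqP => e; apply: none; exists b.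
- by rewrite rmorph0 mul0r add0r.
- by left.
- by move=> c cs e; case: none; exists c.
Qed.

Lemma frac_ext_mono (K L : set U) (x : U) : K `<=` L -> frac_ext K x `<=` frac_ext L x.
Proof.
move=> KL _ [a [b [Ka Kb bx ->]]]; exists a, b.
by split=> // i; apply: KL; [exact: Ka|exact: Kb].
Qed.

(** After taking traces, compare residues at a constant [a] where [f] has a
nonzero one; [E (x - a) = 0] makes [E n / n] regular there. *)
Lemma not_log_exact (K : set U) (d E : U -> U) (x p r : U) f :
  (forall P : {poly U}, exists s, P = lead_coef P *: \prod_(z <- s) ('X - z%:P)) ->
  subfield K -> range iota `<=` K ->
  is_derivation d -> kills d K -> d x = 1 ->
  is_derivation E -> (forall c, K c -> K (E c)) -> kills E (range iota) -> E x = 0 ->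
  dcl (x |` K) p -> dcl (x |` K) r -> p != 0 ->
  (forall g, f <> rat_deriv g) ->
  rat_eval iota f x <> E p / p + d r.
Proof.
move=> splitU fieldK CK derd dK dx derE EK EC Ex xp xr p0 fnd ef.
have ringK := fieldK.1; pose M := frac_ext K x.
have fieldM : subfield M by exact: frac_ext_subfield.
have xKM : x |` K `<=` M.
  by move=> c [->|Kc]; [exact: frac_ext_gen|exact: frac_ext_base].
have KC c : K (iota c) by apply: CK; exact: range_iota.
have dC : kills d (range iota) by move=> c /CK /dK.
have [s [rho [G [a [us CG eG as_ ra]]]]] := residue_exists derd dC dx fnd.
have Mf : M (rat_eval iota f x).
  by apply: (subringM fieldM.1); last apply: fieldM.2;
     apply: frac_ext_horner => // i; rewrite coef_map; exact: KC.
have dM c : M c -> M (d c).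
  apply: frac_ext_stable => //; first by move=> e /dK ->; exact: subring0.
  by rewrite dx; exact: (subring1 fieldM.1).
have EM c : M c -> M (E c).
  by apply: frac_ext_stable => //; rewrite Ex; exact: (subring0 fieldM.1).
have [N [n [t [Mn n0 Mt eN]]]] :=
  log_trace char0 fieldM splitU derd derE dM EM (dclS xKM xp) (dclS xKM xr) p0 Mf ef.
have := @polar_local K d x 1 0 (iota a) s rho fieldK CK derd dK dx
  (subring1 ringK) (subring0 ringK) (KC a) (oner_neq0 _) us.
rewrite !mul1r !addr0 => -[rho0 [h [rh eh _ h0]]].
have {h0} e0 : rho0 = rho a by apply: h0.
have Ka := KC a; have ringO := regular_subring char0 fieldK derd dK dx (iota a).
have Ea : E (iota a) = 0 by apply: EC; exact: range_iota.
have rEn := log_regular char0 fieldK derd dK dx Ka derE EK Ex Ea Mn n0.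
have MG : M G by exact: (frac_ext_mono CK).
pose h' := N.+1%:R * h - E n / n.
have rh' : regular K x (iota a) h'.
  apply: (subringB ringO) => //; apply: (subringM ringO) => //.
  exact: (subring_nat ringO).
have Krho : K (N.+1%:R * iota rho0).
  by apply: (subringM ringK); [exact: subring_nat|exact: KC].
have Mt' : M (t - N.+1%:R * G).
  apply: (subringB fieldM.1) => //; apply: (subringM fieldM.1) => //.
  exact: (subring_nat fieldM.1).
have := exact_no_residue char0 fieldK derd dK dx Ka Mt' rh' Krho.
have -> : d (t - N.+1%:R * G) = N.+1%:R * iota rho0 / (x - iota a) + h'.
  rewrite (derB derd) (derM derd) (der_nat derd) mul0r add0r /h'.
  have -> : d t = N.+1%:R * rat_eval iota f x - E n / n by rewrite eN addrC addKr.
  by rewrite eG eh; ring.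
move=> /(_ erefl)/eqP; rewrite mulf_eq0 (negPf (natr_neq0 char0 N)) fmorph_eq0 e0.
by rewrite (negPf ra).
Qed.

End Core.

(** * Solutions *)

Section Solutions.
Variables (U : fieldType) (k : closedFieldType) (iota : {rmorphism k -> U}).
Variables (delta : U -> U).
Hypothesis char0 : [pchar U] =i pred0.
Hypothesis splitU :
  forall P : {poly U}, exists s, P = lead_coef P *: \prod_(z <- s) ('X - z%:P).
Hypothesis derd : is_derivation delta.
Hypothesis constantsE : constants delta = range iota.

Local Notation "f @! u" := (rat_eval iota f u) (at level 10).

(** The fields over which solutions are studied: relatively algebraically closed
differential subfields containing the constants. *)
Record dbase (K : set U) : Prop := DBase {
  dbase_dcl : dcl K `<=` K;
  dbase_stable : forall c, K c -> K (delta c);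
  dbase_iota : range iota `<=` K }.

Lemma delta_iota c : delta (iota c) = 0.
Proof.
suff : constants delta (iota c) by [].
by rewrite constantsE; exact: range_iota.
Qed.

Lemma dbase_subfield K : dbase K -> subfield K.
Proof.
move=> bK; have -> : K = dcl K by apply/seteqP; split; [exact: sub_dcl|exact: dbase_dcl].
exact: dcl_subfield.
Qed.

Lemma kills_dcl (D : U -> U) S : is_derivation D -> kills D S -> kills D (dcl S).
Proof. by move=> derD DS u; apply. Qed.

Lemma der_separating (S : set U) x : ~ dcl S x ->
  exists D, [/\ is_derivation D, kills D S & D x = 1].
Proof.
move=> /existsNP [D] /not_implyP [derD] /not_implyP [DS /eqP Dx].
exists (fun u => (D x)^-1 * D u); split.
- by split=> u v; rewrite ?(derD_ derD) ?(derM derD); ring.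
- by move=> s Ss; rewrite /= (DS _ Ss) mulr0.
- by rewrite mulVf.
Qed.

Lemma dcl_rat_eval S f u : range iota `<=` S -> dcl S u -> dcl S (f @! u).
Proof.
move=> CS Su; have [ringS invS] := dcl_subfield S.
have h p : dcl S (map_poly iota p).[u].
  apply: (subring_horner ringS) => // i; rewrite coef_map.
  by apply: sub_dcl; apply: CS; exact: range_iota.
by apply: (subringM ringS); [exact: h|apply: invS; exact: h].
Qed.

(** If [z = delta x] were algebraic over [K(x)], then [E = delta - z d] would
kill [x], and [delta z = z f(x)] would read [f(x) = E z / z + d z]. *)
Lemma solution_transcendental K f x : dbase K -> ~ K x ->
  (forall g, f <> rat_deriv g) -> is_solution delta iota f x ->
  ~ dcl (x |` K) (delta x).
Proof.
move=> bK Kx fnd [_ z0 ez] zx; have fieldK := dbase_subfield bK.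
have [d [der_d dK dx]] : exists D, [/\ is_derivation D, kills D K & D x = 1].
  by apply: der_separating => /(dbase_dcl bK).
set z := delta x in z0 ez zx.
pose E u := delta u - z * d u; have derE : is_derivation E by exact: der_comb.
have EK c : K c -> E c = delta c by move=> Kc; rewrite /E dK // mulr0 subr0.
apply: (@not_log_exact _ _ iota char0 K d E x z z f) => //.
- exact: dbase_iota.
- by move=> c Kc; rewrite EK //; exact: dbase_stable.
- move=> _ [c _ <-]; rewrite EK ?delta_iota //.
  by apply: (dbase_iota bK); exact: range_iota.
- by rewrite /E dx mulr1 subrr.
- by rewrite /E ez; field.
Qed.

(** Were [w] not algebraic over [K(x)], the derivations [dx = d/dx] and
[dw = d/dw] in the coordinates [(x, w)] would exist; [delta] expressed in them
leads to a relation excluded by [not_log_exact]. *)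
Lemma exchange_solution K f g x w : dbase K -> ~ K x -> ~ K w ->
  (forall h, f <> rat_deriv h) -> (forall h, g <> rat_deriv h) ->
  is_solution delta iota f x -> is_solution delta iota g w ->
  dcl (delta x |` (x |` K)) w -> dcl (x |` K) w.
Proof.
move=> bK Kx Kw fnd gnd sx sw wxz; apply: contrapT => wx.
have zx := solution_transcendental bK Kx fnd sx.
have qw := solution_transcendental bK Kw gnd sw.
have [_ z0 ez] := sx; have [_ q0 eq] := sw.
set z := delta x in wxz zx z0 ez; set q := delta w in qw q0 eq.
have iK := dbase_iota bK.
pose T := w |` (x |` K).
have Tz : dcl T z by exact: dcl_exchange wxz wx.
have Tq : dcl T q.
  have sub : z |` (x |` K) `<=` dcl T.
    by move=> s [->//|sS]; apply: sub_dcl; right.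
  apply: (dcl_idem sub); apply: (dcl_stable derd) wxz => s.
  have [ringS invS] := dcl_subfield (z |` (x |` K)).
  case=> [->|[->|Ks]].
  - rewrite ez; apply: (subringM ringS); first by apply: sub_dcl; left.
    apply: dcl_rat_eval; first by move=> c /iK Kc; right; right.
    by apply: sub_dcl; right; left.
  - by apply: sub_dcl; left.
  - by apply: sub_dcl; right; right; exact: dbase_stable.
have xw : ~ dcl (w |` K) x.
  by move=> xw; apply: wx; apply: dcl_exchange xw _ => /(dbase_dcl bK).
have [dx [der_x dxS dxx]] := der_separating xw.
have [dw [der_w dwS dww]] := der_separating wx.
have dxK c : K c -> dx c = 0 by move=> Kc; apply: dxS; right.
have dwK c : K c -> dw c = 0 by move=> Kc; apply: dwS; right.
have dxw : dx w = 0 by apply: dxS; left.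
have dwx : dw x = 0 by apply: dwS; left.
have TE : T = x |` (w |` K) by rewrite /T setUCA.
have qx0 : dx q != 0.
  apply/eqP => qx; have : dcl (q |` (w |` K)) x by apply: dcl_exchange qw; rewrite -TE.
  move=> /(_ dx der_x) => h; have /eqP : dx x = 0 by apply: h => s [->//|/dxS].
  by rewrite dxx oner_eq0.
have zw0 : dw z != 0.
  apply/eqP => zw; have : dcl (z |` (x |` K)) w by apply: dcl_exchange zx.
  move=> /(_ dw der_w) => h; have /eqP : dw w = 0 by apply: h => s [->//|/dwS].
  by rewrite dww oner_eq0.
(* The commutator of [D] with [delta], computed in the coordinates: both sides
   agree on [K], [x] and [w]. *)
have commut D u : is_derivation D -> (forall c, K c -> D c = 0) ->
    delta (D x) = 0 -> delta (D w) = 0 -> dcl T u ->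
    D (delta u) = delta (D u) + D z * dx u + D q * dw u.
  move=> derD DK Dx Dw Tu.
  pose C u := D (delta u) - delta (D u) - D z * dx u - D q * dw u.
  have derC : is_derivation C.
    exact (der_comb (D q) (der_comb (D z) (der_commutator derD derd) der_x) der_w).
  have /eqP : C u = 0.
    apply: Tu derC _ => s [->|[->|Ks]]; rewrite /C.
    - by rewrite Dw dxw dww -/q; ring.
    - by rewrite Dx dxx dwx -/z; ring.
    - by rewrite (DK s) // DK ?dxK ?dwK ?(der0 derd) //; [ring|exact: dbase_stable].
  by rewrite /C subr_eq0 !subr_eq => /eqP ->; ring.
have ex := commut _ _ der_x dxK _ _ Tq; have ew := commut _ _ der_w dwK _ _ Tz.
rewrite dxx dxw (der1 derd) (der0 derd) in ex; have {}ex := ex erefl erefl.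
rewrite dww dwx (der1 derd) (der0 derd) in ew; have {}ew := ew erefl erefl.
have dxg : dx (g @! w) = 0.
  apply: dcl_rat_eval der_x dxS; last by apply: sub_dcl; left.
  by move=> c /iK Kc; right.
have dwf : dw (f @! x) = 0.
  apply: dcl_rat_eval der_w dwS; last by apply: sub_dcl; left.
  by move=> c /iK Kc; right.
rewrite eq (derM der_x) dxg mulr0 addr0 in ex.
rewrite ez (derM der_w) dwf mulr0 addr0 in ew.
(* The ratio of the invariant volume forms of the two equations. *)
pose kap := (dx q * z) / (q * dw z).
have kap_const : delta kap = 0.
  have qw0 : q * dw z != 0 by rewrite mulf_neq0.
  rewrite /kap (der_div derd) // !(derM derd) eq ez.
  have -> : delta (dx q) = dx q * g @! w - dx z * dx q - dx q * dw q.
    by rewrite ex; ring.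
  have -> : delta (dw z) = dw z * f @! x - dw z * dx z - dw q * dw z.
    by rewrite ew; ring.
  by field; rewrite q0 zw0.
have [kap0 _ ekap] : range iota kap by rewrite -constantsE.
have kapn0 : kap != 0 by rewrite mulf_neq0 // ?invr_eq0 mulf_neq0.
have Kkap : K kap by rewrite -ekap; apply: iK; exact: range_iota.
pose E u := delta u - z * dx u - q * dw u.
have derE : is_derivation E by exact (der_comb q (der_comb z derd der_x) der_w).
have EK c : K c -> E c = delta c by move=> Kc; rewrite /E dxK // dwK // !mulr0 !subr0.
pose L := dcl (w |` K).
have TL : T `<=` x |` L.
  by rewrite TE => s [->|sS]; [left|right; exact: sub_dcl].
have KL : K `<=` L by move=> c Kc; apply: sub_dcl; right.
have fieldxL := dcl_subfield (x |` L).
have zL : dcl (x |` L) z by exact: (dclS TL).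
have qL : dcl (x |` L) q by exact: (dclS TL).
apply: (@not_log_exact _ _ iota char0 L dx E x z (z + q / kap) f) => //.
- exact: dcl_subfield.
- by move=> c /iK/KL.
- by move=> c Lc; apply: Lc.
- apply: (dcl_stable derE) => s [->|Ks].
    have -> : E w = 0 by rewrite /E dxw dww -/q; ring.
    exact: (subring0 (dcl_subfield _).1).
  by rewrite EK //; apply: KL; exact: dbase_stable.
- move=> _ [c _ <-]; rewrite EK ?delta_iota //.
  by apply: iK; exact: range_iota.
- by rewrite /E dxx dwx -/z; ring.
- apply: (subringD fieldxL.1) => //; apply: (subringM fieldxL.1) => //.
  by apply: fieldxL.2; apply: sub_dcl; right; exact: KL.
- have -> : dx (z + q / kap) = dx z + dx q / kap.
    rewrite (derD_ der_x) (der_div der_x) // (dxK kap) // mulr0 subr0; congr (_ + _).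
    by field.
  rewrite /E ez /kap; field.
  by rewrite q0 z0 qx0 zw0.
Qed.

(** Derive twice with respect to [z]. *)
Lemma quadratic_coef0 (Z : U -> U) a b c z : is_derivation Z -> Z z = 1 ->
  Z a = 0 -> Z b = 0 -> Z c = 0 -> a * z ^+ 2 + b * z + c = 0 -> a = 0 /\ b = 0.
Proof.
move=> derZ Zz Za Zb Zc e; have two0 := natr_neq0 char0 1.
have e1 : 2%:R * a * z + b = 0.
  transitivity (Z (a * z ^+ 2 + b * z + c)); last by rewrite e (der0 derZ).
  by rewrite !(derD_ derZ) !(derM derZ) Zz Za Zb Zc; ring.
have e2 : 2%:R * a = 0.
  transitivity (Z (2%:R * a * z + b)); last by rewrite e1 (der0 derZ).
  by rewrite (derD_ derZ) !(derM derZ) (der_nat derZ) Zz Za Zb; ring.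
move: e1; rewrite e2 mul0r add0r => ->; split=> //.
by apply/eqP; move/eqP: e2; rewrite mulf_eq0 (negPf two0).
Qed.

(** Over the closure [F] of [K(x)], preserved by [d] and by [E = delta - z d],
the equation of [w] is quadratic in [z]. The coefficient of [z ^+ 2] gives
[d (d w) = 0], hence [w = al * x + be]; that of [z] gives
[al * (g(w) - f(x)) = 2 * al']. The right-hand side has no residue, so the
residues of [g(w)] and [f(x)] in [x] agree, and they determine [al] and [be] in
terms of constants. *)
Lemma affine_solution K f g x w : dbase K -> ~ K x -> ~ K w ->
  (forall h, f <> rat_deriv h) -> (forall h, g <> rat_deriv h) ->
  is_solution delta iota f x -> is_solution delta iota g w ->
  dcl (x |` K) w -> exists a b : k, a != 0 /\ w = iota a * x + iota b.
Proof.
move=> bK Kx Kw fnd gnd sx sw Fw.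
have zF := solution_transcendental bK Kx fnd sx.
have [_ z0 ez] := sx; have [_ q0 eq] := sw.
set z := delta x in zF z0 ez.
have iK := dbase_iota bK; have fieldK := dbase_subfield bK; have ringK := fieldK.1.
have Kiota c : K (iota c) by apply: iK; exact: range_iota.
have [d [der_d dK dx]] : exists D, [/\ is_derivation D, kills D K & D x = 1].
  by apply: der_separating => /(dbase_dcl bK).
have [Z [derZ ZS Zz]] := der_separating zF.
have ZF := kills_dcl derZ ZS.
set F := dcl (x |` K) in Fw ZF; have [ringF invF] : subfield F by exact: dcl_subfield.
have KF : K `<=` F by move=> c Kc; apply: sub_dcl; right.
have Fx : F x by apply: sub_dcl; left.
pose E u := delta u - z * d u; have derE : is_derivation E by exact: der_comb.
have EK c : K c -> E c = delta c by move=> Kc; rewrite /E dK // mulr0 subr0.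
have Ex : E x = 0 by rewrite /E dx mulr1 subrr.
have dF u : F u -> F (d u).
  apply: (dcl_stable der_d) => s [->|Ks].
    by rewrite dx; exact: (subring1 ringF).
  by rewrite dK //; exact: (subring0 ringF).
have EF u : F u -> F (E u).
  apply: (dcl_stable derE) => s [->|Ks]; first by rewrite Ex; exact: (subring0 ringF).
  by rewrite EK //; apply: KF; exact: dbase_stable.
have deltaE u : delta u = E u + z * d u by rewrite subrK.
have Ff : F (f @! x) by apply: dcl_rat_eval => // c /iK Kc; right.
have Fg : F (g @! w).
  have sub : w |` (x |` K) `<=` F by move=> s [->|sS] //; exact: sub_dcl.
  apply: (dcl_idem sub); apply: dcl_rat_eval; first by move=> c /iK Kc; right; right.
  by apply: sub_dcl; left.
have [ddw0 emid] : d (d w) = 0 /\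
    d (E w) + E (d w) + d w * (f @! x - g @! w) = 0.
  apply: (@quadratic_coef0 Z _ _ (E (E w) - E w * g @! w) z) => //.
  - by apply: ZF; apply/dF/dF.
  - apply: ZF; apply: (subringD ringF); last first.
      by apply: (subringM ringF); [exact: dF|exact: (subringB ringF)].
    by apply: (subringD ringF); [apply: dF; exact: EF|apply: EF; exact: dF].
  - apply: ZF; apply: (subringB ringF); first by apply/EF/EF.
    by apply: (subringM ringF) => //; exact: EF.
  - move: eq; rewrite {1}[delta w]deltaE (derD_ derd) (derM derd) -/z ez.
    rewrite [delta (E w)]deltaE [delta (d w)]deltaE [delta w]deltaE => /eqP.
    by rewrite -subr_eq0 => /eqP <-; ring.
(* [d] has no new constants in [F]. *)
have ker_d u : F u -> d u = 0 -> K u.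
  move=> Fu du; apply: contrapT => Ku.
  have /= := dcl_exchange Fu (fun h => Ku (dbase_dcl bK h)).
  move=> /(_ d der_d) h; have /eqP : d x = 0 by apply: h => s [->//|/dK].
  by rewrite dx oner_eq0.
pose al := d w; pose be := w - al * x.
have Kal : K al by apply: ker_d => //; exact: dF.
have Kbe : K be.
  apply: ker_d.
    by apply: (subringB ringF) => //; apply: (subringM ringF) => //; exact: KF.
  by rewrite (derB der_d) (derM der_d) (dK al) // dx mul0r add0r mulr1 subrr.
have ew : w = al * x + be by rewrite /be addrC subrK.
have al0 : al != 0.
  by apply/eqP => al0; apply: Kw; rewrite ew al0 mul0r add0r.
have Kal' : K (delta al) by exact: dbase_stable.
have efg : al * (g @! w - f @! x) = 2%:R * delta al.
  move: emid; have -> : E w = delta al * x + delta be.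
    by rewrite {1}ew (derD_ derE) (derM derE) Ex !EK // mulr0 addr0.
  rewrite -/al (EK al) // (derD_ der_d) (derM der_d) dx !(dK (delta _)) //;
    last exact: dbase_stable.
  by move=> /eqP; rewrite mul0r add0r mulr1 addr0 addrC addr_eq0 => /eqP h;
     rewrite -opprB mulrN h; ring.
have dC : kills d (range iota) by move=> c /iK/dK.
have [s [rho [G [a [us CG eG as_ ra]]]]] := residue_exists char0 der_d dC dx fnd.
pose d' u := al^-1 * d u.
have derd' : is_derivation d'.
  by split=> u v; rewrite /d' ?(derD_ der_d) ?(derM der_d); ring.
have d'C : kills d' (range iota) by move=> c /dC h; rewrite /d' h mulr0.
have d'w : d' w = 1 by rewrite /d' -/al mulVf.
have [s2 [rho2 [G2 [_ [us2 CG2 eG2 _ _]]]]] := residue_exists char0 derd' d'C d'w gnd.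
have Ka := Kiota a.
have := @polar_local U k iota char0 K d x 1 0 (iota a) s rho fieldK iK der_d dK dx
  (subring1 ringK) (subring0 ringK) Ka (oner_neq0 _) us.
rewrite !mul1r !addr0 => -[r1 [h1 [rh1 eh1 _ er1]]].
have {}er1 : r1 = rho a by apply: er1.
have := @polar_local U k iota char0 K d x al be (iota a) s2 rho2 fieldK iK der_d dK dx
  Kal Kbe Ka al0 us2.
rewrite -ew => -[r2 [h2 [rh2 eh2 or2 _]]].
have ringO := regular_subring char0 fieldK der_d dK dx (iota a).
have [ringM invM] := frac_ext_subfield x ringK.
have Mx := frac_ext_gen x ringK.
have MK c : K c -> frac_ext K x c by move=> Kc; exact: frac_ext_base.
have Mw : frac_ext K x w.
  by rewrite ew; apply: (subringD ringM); [apply: (subringM ringM) => //; exact: MK|exact: MK].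
have MG : frac_ext K x G by exact: (frac_ext_mono iK).
have MG2 : frac_ext K x G2.
  have [P [Q [CP CQ _ ->]]] := CG2.
  by apply: (subringM ringM); last apply: invM;
     apply: (subring_horner ringM) => // i; apply: MK; apply: iK.
(* A primitive of the difference of the polar parts. *)
pose t := G - al^-1 * G2 + 2%:R * delta al / al * x.
have Mt : frac_ext K x t.
  apply: (subringD ringM).
    by apply: (subringB ringM) => //; apply: (subringM ringM) => //; apply: invM; exact: MK.
  apply: (subringM ringM) => //; apply: MK.
  apply: (subringM ringK); last exact: fieldK.2.
  by apply: (subringM ringK) => //; exact: subring_nat.
have Krho : K (iota r2 / al - iota r1).
  by apply: (subringB ringK) => //; apply: (subringM ringK) => //; exact: fieldK.2.
have xa0 : x - iota a != 0 by exact: (sub_iota_neq0 dC dx).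
have /eqP : iota r2 / al - iota r1 = 0.
  apply: (exact_no_residue char0 fieldK der_d dK dx Ka Mt (subringB ringO rh2 rh1) Krho).
  have Kc : K (2%:R * delta al / al).
    apply: (subringM ringK); last exact: fieldK.2.
    by apply: (subringM ringK) => //; exact: subring_nat.
  rewrite /t (derD_ der_d) (derB der_d) !(derM der_d _ G2) (derM der_d _ x) dx (dK _ Kc).
  rewrite (dK al^-1) ?mul0r ?add0r; last exact: fieldK.2.
  have -> : d G = f @! x - polar iota s rho x by rewrite eG addrK.
  have -> : al^-1 * d G2 = g @! w - polar iota s2 rho2 w by rewrite eG2 addrK.
  have -> : 2%:R * delta al / al = g @! w - f @! x by rewrite -efg; field.
  by rewrite eh1 eh2; field; rewrite xa0 al0.
rewrite subr_eq0 er1 => /eqP er.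
have r20 : r2 != 0.
  apply: contraNneq ra => r20; move/eqP: er.
  by rewrite r20 rmorph0 mul0r eq_sym fmorph_eq0.
case: or2 => [/eqP|[c _ ec]]; first by rewrite (negPf r20).
have eal : al = iota (r2 / rho a).
  rewrite fmorph_div -er; field.
  by rewrite fmorph_eq0 r20 al0.
exists (r2 / rho a), (c - r2 / rho a * a); split.
  by rewrite mulf_neq0 ?invr_eq0.
by rewrite [iota (c - _)]rmorphB [iota (_ * a)]rmorphM -eal -ec {1}ew; ring.
Qed.

End Solutions.

(** * Algebraic independence *)

(** The axiom for differential polynomials of order 0 says that [U] is
algebraically closed. *)
Lemma DCF0_root (U : fieldType) (delta : U -> U) (P : {poly U}) :
  is_DCF0 delta -> (1 < size P)%N -> exists x, P.[x] = 0.
Proof.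
move=> U_DCF0 sP.
pose f : {mpoly U[1]} := \sum_(i < size P) P`_i *: 'X_ord0 ^+ i.
have [||x [fx _]] := DCF0_closed U_DCF0 (n := 0) (f := f) (g := 1).
- have lP : lead_coef P != 0 by rewrite lead_coef_eq0 -size_poly_gt0 ltnW.
  have P0 : (0 < size P)%N by apply: ltnW.
  exists (U_(ord0) *+ (size P).-1)%MM; last first.
    rewrite (_ : ord_max = ord0); last by apply: val_inj.
    by rewrite mulmnE mnm1E eqxx mul1n -lt0n -ltnS prednK.
  have lt : ((size P).-1 < size P)%N by rewrite prednK.
  rewrite mcoeff_msupp /f (raddf_sum (mcoeff _)) (bigD1 (Ordinal lt)) //= big1 ?addr0.
    by rewrite mcoeffZ mpolyXn mcoeffX eqxx mulr1.
  move=> i ni; rewrite mcoeffZ mpolyXn mcoeffX.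
  case: eqP => [/mnmP/(_ ord0)|_]; last by rewrite mulr0.
  rewrite !mulmnE !mnm1E !mul1n => e; case/eqP: ni.
  by apply: val_inj.
- exact: oner_neq0.
exists x; rewrite horner_coef; apply: etrans fx; rewrite /deval /f raddf_sum /=.
by apply: eq_bigr => i _; rewrite mevalZ rmorphXn /= mevalXU.
Qed.

Lemma DCF0_split (U : fieldType) (delta : U -> U) (P : {poly U}) :
  is_DCF0 delta -> exists s, P = lead_coef P *: \prod_(z <- s) ('X - z%:P).
Proof.
move=> U_DCF0; have [n] := ubnP (size P); elim: n P => // n IH P sP.
have [sP1|sP1] := leqP (size P) 1.
  exists [::]; rewrite big_nil alg_polyC {1}(size1_polyC sP1).
  by rewrite /lead_coef; case: (size P) sP1 => [|[|]].
have [x /rootP/factor_theorem [Q eP]] := DCF0_root U_DCF0 sP1.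
have Q0 : Q != 0 by apply: contraTneq sP1 => Q0; rewrite eP Q0 mul0r size_poly0.
have [|s es] := IH Q.
  by move: sP; rewrite eP size_Mmonic ?monicXsubC // size_XsubC addn2.
have lP : lead_coef P = lead_coef Q by rewrite eP lead_coefM lead_coefXsubC mulr1.
by exists (x :: s); rewrite big_cons lP {1}eP {1}es -scalerAl [_ * ('X - _)]mulrC.
Qed.

Section Independence.
Variables (U : fieldType) (k : fieldType) (iota : {rmorphism k -> U}).
Hypothesis char0 : [pchar U] =i pred0.

(** The chain rule. *)
Lemma der_mmap (m : nat) (b : 'I_m -> U) D (p : {mpoly k[m]}) : is_derivation D ->
  kills D (range iota) ->
  D (mmap iota b p) = \sum_i mmap iota b p^`M(i) * D (b i).
Proof.
move=> derD DC; pose good q := D (mmap iota b q) = \sum_i mmap iota b q^`M(i) * D (b i).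
have mM q r : mmap iota b (q * r) = mmap iota b q * mmap iota b r.
  exact: (mmap_is_multiplicative b iota).1.
have goodD q r : good q -> good r -> good (q + r).
  rewrite /good !raddfD /= (derD_ derD) => -> ->; rewrite -big_split /=.
  by apply: eq_bigr => i _; rewrite mderivD raddfD mulrDl.
have goodM q r : good q -> good r -> good (q * r).
  rewrite /good !mM (derM derD) => -> ->; rewrite mulr_suml mulr_sumr -big_split /=.
  by apply: eq_bigr => i _; rewrite mderivM raddfD /= !mM; ring.
have goodC c : good c%:MP.
  rewrite /good mmapC DC; last by exists c.
  by rewrite big1 // => i _; rewrite mderivC raddf0 mul0r.
have goodX i : good 'X_i.
  have dX l : 'X_i^`M(l) = (l == i)%:R :> {mpoly k[m]}.
    rewrite mderivX mnm1E eq_sym; case: eqP => [->|_]; last by rewrite scale0r.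
    by rewrite scale1r -{1}[U_(i)%MM]add0m addmK mpolyX0.
  rewrite /good mmapX mmap1U (bigD1 i) //= dX eqxx rmorph1 mul1r big1 ?addr0 //.
  by move=> l /negPf li; rewrite dX li raddf0 mul0r.
have goodXm (mm : 'X_{1..m}) : good 'X_[mm].
  rewrite mpolyXE_id; elim/big_ind: _ => //; first exact: (goodC 1).
  move=> i _; elim: (mm i) => [|e IH]; first exact: (goodC 1).
  by rewrite exprS; exact: goodM.
suff : good p by [].
elim/mpolyind: p => [|c mm q _ _ gq]; first exact: (goodC 0).
by apply: goodD => //; rewrite -mul_mpolyC; apply: goodM.
Qed.

Lemma mderiv_size_lt (m : nat) (p : {mpoly k[m]}) i : p != 0 ->
  (msize p^`M(i) < msize p)%N.
Proof.
move=> p0; rewrite -[X in (_ < X)%N]prednK ?lt0n ?msize_poly_eq0 // ltnS msizeE.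
apply/bigmax_leqP_seq => mm; rewrite mcoeff_msupp mcoeff_deriv => h _.
have : (mm + U_(i))%MM \in msupp p.
  by rewrite mcoeff_msupp; apply: contraNneq h => ->; rewrite mul0rn.
move/msize_mdeg_lt; rewrite mdegD mdeg1 addn1.
by case: (msize p).
Qed.

(** For each [j] a derivation over the base field kills [b_i] for [i < j] and not
[b_j]. Applied to a relation [p(b) = 0], this triangular system shows that all
the partial derivatives of [p] vanish at [b] too; being of smaller size, they
are 0 by induction, and [p] is constant. *)
Lemma alg_independent_dcl (m : nat) (b : 'I_m -> U) :
  (forall j : 'I_m,
    ~ dcl (range iota `|` [set b i | i in [set i : 'I_m | (i < j)%N]]) (b j)) ->
  alg_independent iota b.
Proof.
move=> indep p; apply: contra_neq.
have [n] := ubnP (msize p); elim: n p => // n IH p sp bp.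
apply: contrapT => /eqP p0.
have dp0 i : mmap iota b p^`M(i) = 0.
  have [e] := ubnP (m - i)%N; elim: e i => // e IHe i me.
  have [D [derD DS Db]] := der_separating (indep i).
  have DC : kills D (range iota) by move=> c Cc; apply: DS; left.
  have := der_mmap b p derD DC; rewrite bp (der0 derD) (bigD1 i) //= Db mulr1 big1 ?addr0 //.
  move=> l li; have [lt|ge] := ltnP l i.
    by rewrite (DS (b l)) ?mulr0 //; right; exists l.
  by rewrite IHe ?mul0r //; move: me (ltn_ord l) li ge; rewrite -val_eqE /=; lia.
have dp i : p^`M(i) = 0.
  apply: IH (dp0 i); rewrite ltnS in sp; apply: leq_trans sp.
  exact: mderiv_size_lt.
have chark e : (e.+1%:R : k) != 0 by rewrite -(fmorph_eq0 iota) rmorph_nat natr_neq0.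
have pC : p = (p@_0)%:MP.
  apply/mpolyP => mm; rewrite mcoeffC; have [->|mm0] := eqVneq 0%MM mm; first by rewrite mulr1.
  rewrite mulr0; have [i mi] : exists i, mm i != 0%N.
    apply: contrapT => none; move/eqP: mm0; apply; apply/mnmP => i; rewrite mnm0E.
    by apply/eqP; rewrite eq_sym; apply: contrapT => h; apply: none; exists i; apply/negP.
  have := congr1 (mcoeff (mm - U_(i))) (dp i).
  rewrite mcoeff_deriv mcoeff0 submK; last first.
    by apply/mnm_lepP => l; rewrite mnm1E; case: eqP => // <-; rewrite lt0n.
  by move/eqP; rewrite -mulr_natr mulf_eq0 (negPf (chark _)) orbF => /eqP.
move: bp; rewrite pC mmapC => /eqP; rewrite fmorph_eq0 => /eqP h.
by move: p0; rewrite pC h mpolyC0 eqxx.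
Qed.

End Independence.

(** * Families of solutions *)

Section Families.
Variables (U : fieldType) (k : closedFieldType) (iota : {rmorphism k -> U}).
Variables (delta : U -> U).
Hypothesis char0 : [pchar U] =i pred0.
Hypothesis splitU :
  forall P : {poly U}, exists s, P = lead_coef P *: \prod_(z <- s) ('X - z%:P).
Hypothesis derd : is_derivation delta.
Hypothesis constantsE : constants delta = range iota.
Variables (n : nat) (f : 'I_n -> {fraction {poly k}}) (y : 'I_n -> U).
Hypothesis f_not_deriv : forall i g, f i <> rat_deriv g.
Hypothesis y_sol : forall i, is_solution delta iota (f i) (y i).

Definition gens (S : {set 'I_n}) : set U :=
  range iota `|` [set u | exists2 i, i \in S & u = y i \/ u = delta (y i)].

Lemma gens_dbase S : dbase iota delta (dcl (gens S)).
Proof.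
have iS : range iota `<=` gens S by move=> c; left.
have Sy i : i \in S -> dcl (gens S) (y i).
  by move=> iSi; apply: sub_dcl; right; exists i => //; left.
have Sd i : i \in S -> dcl (gens S) (delta (y i)).
  by move=> iSi; apply: sub_dcl; right; exists i => //; right.
split.
- by apply: dcl_idem.
- move=> c; apply: (dcl_stable derd) => s [[c' _ <-]|[i iSi [->|->]]].
  + by rewrite (delta_iota constantsE); exact: (subring0 (dcl_subfield _).1).
  + exact: Sd.
  + have [_ _ ->] := y_sol i; apply: (subringM (dcl_subfield _).1); first exact: Sd.
    have sub : y i |` gens S `<=` dcl (gens S) by move=> s' [->|h]; [exact: Sy|exact: sub_dcl].
    apply: (dcl_idem sub); apply: dcl_rat_eval; first by move=> e /iS h; right.
    by apply: sub_dcl; left.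
- by move=> c /iS; exact: sub_dcl.
Qed.

Hypothesis indep : ~ (exists (i j : 'I_n) (a b : k),
  [/\ i != j, a != 0 & y i = iota a * y j + iota b]).

(** Take a dependence on the smallest possible [S] and single out one [j] in [S]:
over the closure of the rest, [y i] depends on [y j] and its derivative, so
that [affine_solution] provides a forbidden relation. *)
Lemma solution_notin_dcl (S : {set 'I_n}) i : i \notin S -> ~ dcl (gens S) (y i).
Proof.
have [m] := ubnP #|S|; elim: m S i => // m IH S i Sm iS yi.
have [S0|[j jS]] := set_0Vmem S.
  have [_ /eqP d0 _] := y_sol i; apply: d0; apply: yi derd _ => s [[c _ <-]|[l]].
    exact: (delta_iota constantsE).
  by rewrite S0 inE.
have ij : i != j by apply: contraNneq iS => ->.
set S' := S :\ j; have S'm : (#|S'| < m)%N.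
  by move: Sm; rewrite (cardsD1 j) jS.
have yj' : ~ dcl (gens S') (y j) by apply: IH => //; rewrite !inE eqxx.
have yi' : ~ dcl (gens S') (y i) by apply: IH => //; rewrite !inE negb_and iS orbT.
have bS' := gens_dbase S'.
have yij : dcl (delta (y j) |` (y j |` dcl (gens S'))) (y i).
  apply: dclS yi => s [Cs|[l lS h]].
    by right; right; apply: sub_dcl; left.
  have [ljj|lj] := eqVneq l j.
    by rewrite ljj in h; case: h => ->; [right; left|left].
  by right; right; apply: sub_dcl; right; exists l => //; rewrite !inE lj.
have yij' := exchange_solution char0 splitU derd constantsE bS' yj' yi'
  (@f_not_deriv j) (@f_not_deriv i) (y_sol j) (y_sol i) yij.
have [a [b [a0 e]]] := affine_solution char0 splitU derd constantsE bS' yj' yi'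
  (@f_not_deriv j) (@f_not_deriv i) (y_sol j) (y_sol i) yij'.
by apply: indep; exists i, j, a, b.
Qed.

Lemma half_ltn (j : 'I_(2 * n)) : (j./2 < n)%N.
Proof. by rewrite ltn_half_double -mul2n. Qed.

(** The sequence y_0, y_0', y_1, y_1', ... *)
Definition family (j : 'I_(2 * n)) : U :=
  let yj := y (Ordinal (half_ltn j)) in if odd j then delta yj else yj.

Lemma family_independent : alg_independent iota family.
Proof.
apply: alg_independent_dcl => // j; set h := Ordinal (half_ltn j).
pose S := [set l : 'I_n | (l < h)%N]%SET.
have hS : h \notin S by rewrite inE ltnn.
have yh := solution_notin_dcl hS.
have earlier (i : 'I_(2 * n)) : (i < j)%N ->
    gens S (family i) \/ odd j /\ family i = y h.
  move=> ij; have := half_leq (ltnW ij); rewrite leq_eqVlt => /orP[/eqP e|lt].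
    right; have eh : Ordinal (half_ltn i) = h by apply: val_inj.
    have [oi oj] : ~~ odd i /\ odd j.
      by move: e ij; rewrite -(odd_double_half i) -(odd_double_half j);
         case: (odd i); case: (odd j); rewrite /= !odd_double /= => e; lia.
    by rewrite /family (negPf oi) eh.
  left; right; exists (Ordinal (half_ltn i)); first by rewrite inE.
  by rewrite /family; case: ifP; [right|left].
rewrite {2}/family -/h; case: ifP => oj.
  have := solution_transcendental char0 splitU derd constantsE (gens_dbase S) yh
    (@f_not_deriv h) (y_sol h).
  move=> nd hd; apply: nd; apply: dclS hd => s [Cs|[i ij <-]].
    by right; apply: sub_dcl; left.
  by case: (earlier i ij) => [g|[_ ->]]; [right; exact: sub_dcl|left].
move=> hd; apply: yh; apply: dclS hd => s [Cs|[i ij <-]]; first by left.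
by case: (earlier i ij) => [//|[]]; rewrite oj.
Qed.

Lemma family_generates (i : 'I_n) :
  (exists j, y i = family j) /\ (exists j, delta (y i) = family j).
Proof.
have lt0 : (i.*2 < 2 * n)%N by have := ltn_ord i; lia.
have lt1 : (i.*2.+1 < 2 * n)%N by have := ltn_ord i; lia.
split.
  exists (Ordinal lt0); rewrite /family /= odd_double; congr (y _).
  by apply: val_inj; rewrite /= doubleK.
exists (Ordinal lt1); rewrite /family /= odd_double /=; congr (delta (y _)).
by apply: val_inj; rewrite /= uphalf_double.
Qed.

End Families.

(** Since [w' = a x'], both equations give the value of [w'' / w'], that is
[g(x) = f(a x + b)]; and [x], having nonzero derivative, is transcendental over
the constants. *)
Lemma affine_solution_eq (U : fieldType) (k : closedFieldType)
    (iota : {rmorphism k -> U}) (delta : U -> U) (f g : {fraction {poly k}})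
    (x w : U) (a b : k) :
  [pchar U] =i pred0 -> is_derivation delta -> constants delta = range iota ->
  is_solution delta iota f w -> is_solution delta iota g x ->
  a != 0 -> w = iota a * x + iota b -> g = rat_affine f a b.
Proof.
move=> char0 derd constantsE [fw w0 ew] [gx x0 ex] a0 e.
have ia0 : iota a != 0 by rewrite fmorph_eq0.
have di := delta_iota constantsE.
pose d u := (delta x)^-1 * delta u.
have derd' : is_derivation d.
  by split=> u v; rewrite /d ?(derD_ derd) ?(derM derd); ring.
have dC : kills d (range iota) by move=> _ [c _ <-]; rewrite /d di mulr0.
have dx : d x = 1 by rewrite /d mulVf.
have xtr := iota_transc char0 derd' dC dx.
have horner_affine p :
    (map_poly iota (p \Po (a *: 'X + b%:P))).[x] = (map_poly iota p).[w].
  rewrite map_comp_poly horner_comp e; congr (_.[_]).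
  by rewrite rmorphD /= map_polyZ map_polyX map_polyC !(hornerD, hornerZ) hornerX hornerC.
apply: (rat_eval_inj xtr).
  by apply/eqP => B0; apply: fw; rewrite /is_pole -horner_affine B0 rmorph0 horner0.
rewrite !horner_affine -/(rat_eval iota f w).
have dw : delta w = iota a * delta x.
  by rewrite e (derD_ derd) (derM derd) !di mul0r add0r addr0.
move: ew; rewrite dw (derM derd) di mul0r add0r ex -mulrA.
by move=> /(mulfI ia0)/(mulfI x0).
Qed.

Theorem theorem6p1 (R : realType) (U : fieldType) (delta : U -> U)
    (U_DCF0 : is_DCF0 delta) (U_saturated : is_saturated delta)
    (iota : {rmorphism R[i] -> U}) (U_constants : constants delta = range iota)
    (n : nat) (f : 'I_n -> {fraction {poly R[i]}}) (y : 'I_n -> U)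
    (f_not_deriv : forall (i : 'I_n) (g : {fraction {poly R[i]}}),
        f i <> rat_deriv g)
    (y_sol : forall i : 'I_n, is_solution delta iota (f i) (y i)) :
  (~ (exists (i j : 'I_n) (a b : R[i]),
        [/\ i != j, a != 0 & y i = iota a * y j + iota b]) ->
   has_trdeg iota (adjoin iota (range y `|` range (delta \o y))) (2 * n)) /\
  (forall (i j : 'I_n) (a b : R[i]),
     i != j -> a != 0 -> y i = iota a * y j + iota b ->
     f j = rat_affine (f i) a b).
Proof.
have char0 := DCF0_char0 U_DCF0; have derd := DCF0_derivation U_DCF0.
split; last first.
  move=> i j a b _ a0 e.
  exact: affine_solution_eq char0 derd U_constants (y_sol i) (y_sol j) a0 e.
move=> indep; have splitU P := DCF0_split P U_DCF0.
pose b := family delta y; exists b.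
have gen (K : set U) : range iota `|` range b `<=` K ->
    range iota `|` (range y `|` range (delta \o y)) `<=` K.
  move=> bK _ [[c _ <-]|[[i _ <-]|[i _ <-]]]; apply: bK; first by left; exists c.
    by have [[j ->] _] := family_generates delta y i; right; exists j.
  by have [_ [j /= ->]] := family_generates delta y i; right; exists j.
split.
- move=> j K [_ sub]; apply: sub; right.
  by rewrite /b /family; case: ifP => _; [right|left]; exists (Ordinal (half_ltn j)).
- exact: (family_independent char0 splitU derd U_constants f_not_deriv y_sol indep).
- move=> u Lu; have bu : adjoin iota (range b) u.
    by move=> K [ringK sub]; apply: Lu; split=> //; exact: gen.
  exists ('X - u%:P); split; first exact: monic_neq0 (monicXsubC u).
    move=> i K [ringK sub]; have /= Ku := bu K (conj ringK sub).
    have [K1 KB _] := ringK; rewrite -/(K _); apply/set_mem.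
    have K0 := KB _ _ K1 K1; rewrite subrr in K0.
    rewrite coefB coefX coefC; apply: KB; first by case: (i == 1%N).
    by case: (i == 0%N) => //; exact/mem_set.
  by rewrite root_XsubC.
Qed.
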